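(* Let $\mathcal C$ be a modular tensor category with set $I$ of representatives of simple objects, unit $0\in I$, and modular $S$-matrix $(S_{ij})_{i,j\in I}$. For $p_1,\dots,p_n\in I$, $$\dim\mathrm{Bl}(p_1,\dots,p_n)=\sum_{j\in I}\frac{\prod_{a=1}^nS_{p_aj}}{S_{0j}^{\,n}}.$$
   Context: $i^\ast$ denotes the rigid dual of $i$. The $n$-point conformal block space is $\mathrm{Bl}(p_1,\dots,p_n)=\bigoplus_{i\in I}\mathrm{Hom}_{\mathcal C}(p_1\otimes\cdots\otimes p_n,\,i\otimes i^\ast)$. $S$ is the normalized (unitary) modular $S$-matrix, diagonalizing the fusion rules $N_{ab}^c=\dim\mathrm{Hom}_{\mathcal C}(a\otimes b,c)$ via the Verlinde formula. *)

(* Defs.v *)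
From HB Require Import structures.
From mathcomp Require Import all_boot all_order all_algebra.

Set Implicit Arguments.
Unset Strict Implicit.
Unset Printing Implicit Defensive.

Import GRing.Theory Num.Theory.
Local Open Scope ring_scope.

(* The (external) direct sum of a finite family of finite-dimensional vector
   spaces; mathcomp only provides the non-dependent {ffun I -> V}. *)
Section DirectSum.
Variables (K : fieldType) (I : finType) (V : I -> vectType K).

Definition dsum : Type := {dffun forall i : I, V i}.

HB.instance Definition _ := Choice.on dsum.

Implicit Types f g h : dsum.

Definition dsum_zero : dsum := [ffun i => 0 : V i].
Definition dsum_opp f : dsum := [ffun i => - f i : V i].
Definition dsum_add f g : dsum := [ffun i => f i + g i : V i].
Definition dsum_scale (a : K) f : dsum := [ffun i => a *: f i : V i].

Fact dsum_addA : associative dsum_add.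
Proof. by move=> f g h; apply/ffunP => i; rewrite !ffunE addrA. Qed.
Fact dsum_addC : commutative dsum_add.
Proof. by move=> f g; apply/ffunP => i; rewrite !ffunE addrC. Qed.
Fact dsum_add0 : left_id dsum_zero dsum_add.
Proof. by move=> f; apply/ffunP => i; rewrite !ffunE add0r. Qed.
Fact dsum_addN : left_inverse dsum_zero dsum_opp dsum_add.
Proof. by move=> f; apply/ffunP => i; rewrite !ffunE addNr. Qed.

HB.instance Definition _ :=
  GRing.isZmodule.Build dsum dsum_addA dsum_addC dsum_add0 dsum_addN.

Fact dsum_scaleA a b f : dsum_scale a (dsum_scale b f) = dsum_scale (a * b) f.
Proof. by apply/ffunP => i; rewrite !ffunE scalerA. Qed.
Fact dsum_scale1 : left_id 1 dsum_scale.
Proof. by move=> f; apply/ffunP => i; rewrite !ffunE scale1r. Qed.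
Fact dsum_scaleDr : right_distributive dsum_scale +%R.
Proof. by move=> a f g; apply/ffunP => i; rewrite !ffunE scalerDr. Qed.
Fact dsum_scaleDl f : {morph dsum_scale^~ f : a b / a + b}.
Proof. by move=> a b; apply/ffunP => i; rewrite !ffunE scalerDl. Qed.

HB.instance Definition _ := GRing.Zmodule_isLmodule.Build K dsum
  dsum_scaleA dsum_scale1 dsum_scaleDr dsum_scaleDl.

Let dsum_dim := #|{: {i : I & 'I_(dim (V i))}}|.

Import VectorInternalTheory.

Fact dsum_vect_iso : Vector.axiom dsum_dim dsum.
Proof.
pose coo f (u : {i : I & 'I_(dim (V i))}) := v2r (f (tag u)) 0 (tagged u).
exists (fun f => \row_k coo f (enum_val k)).
  move=> a f g; apply/rowP => k; rewrite !mxE /coo; set u := enum_val k.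
  have -> : (a *: f + g : dsum) (tag u) = a *: f (tag u) + g (tag u).
    by rewrite ffunE; congr (_ + _); rewrite ffunE.
  by rewrite semilinearP mxE linearZ mxE.
exists (fun r : 'rV_dsum_dim =>
    [ffun i => r2v (\row_j r 0 (enum_rank (Tagged _ j))) : V i] : dsum).
  move=> f; apply/ffunP => i; rewrite ffunE.
  by apply: (canLR (@v2rK _ _)); apply/rowP => j; rewrite !mxE enum_rankK.
move=> r; apply/rowP => k; rewrite !mxE /coo ffunE r2vK mxE.
rewrite -[in RHS](enum_valK k); congr (r 0 (enum_rank _)).
by case: (enum_val k).
Qed.

HB.instance Definition _ := Lmodule_hasFinDim.Build K dsum dsum_vect_iso.

End DirectSum.

Declare Scope cat_scope.
Delimit Scope cat_scope with cat.
Local Open Scope cat_scope.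

Record linCategory (K : fieldType) := LinCategory {
  obj :> Type;
  mor : obj -> obj -> vectType K;
  idm : forall x, mor x x;
  comp : forall x y z, mor y z -> mor x y -> mor x z;
  comp1m : forall x y (f : mor x y), comp (idm y) f = f;
  compm1 : forall x y (f : mor x y), comp f (idm x) = f;
  compA : forall x y z t (f : mor z t) (g : mor y z) (h : mor x y),
    comp f (comp g h) = comp (comp f g) h;
  comp_linl : forall x y z (g : mor x y), linear (fun f : mor y z => comp f g);
  comp_linr : forall x y z (f : mor y z), linear (fun g : mor x y => comp f g)
}.
Arguments mor {K l} x y.
Arguments idm {K l} x.
Arguments comp {K l x y z} f g.

Notation "f ∘ g" := (comp f g) (at level 40, left associativity) : cat_scope.

Section AbelianCategories.
Variables (K : fieldType) (C : linCategory K).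
Implicit Types x y z w : C.

Record iso x y := Iso {
  isom :> mor x y;
  isoinv : mor y x;
  isoK : isoinv ∘ isom = idm x;
  isoinvK : isom ∘ isoinv = idm y
}.

Definition isomorphic x y : Prop := inhabited (iso x y).

Definition is_iso x y (f : mor x y) : Prop :=
  exists g : mor y x, g ∘ f = idm x /\ f ∘ g = idm y.

Definition mono x y (f : mor x y) : Prop :=
  forall z (g h : mor z x), f ∘ g = f ∘ h -> g = h.

Definition epi x y (f : mor x y) : Prop :=
  forall z (g h : mor y z), g ∘ f = h ∘ f -> g = h.

Definition is_zero x : Prop :=
  forall y, (forall f : mor x y, f = 0) /\ (forall f : mor y x, f = 0).

Definition is_kernel x y z (f : mor x y) (k : mor z x) : Prop :=
  f ∘ k = 0 /\
  forall w (g : mor w x), f ∘ g = 0 -> exists! h : mor w z, k ∘ h = g.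

Definition is_cokernel x y z (f : mor x y) (q : mor y z) : Prop :=
  q ∘ f = 0 /\
  forall w (g : mor y w), g ∘ f = 0 -> exists! h : mor z w, h ∘ q = g.

Definition is_direct_sum n (s : 'I_n -> C) x : Prop :=
  exists (inj : forall k, mor (s k) x) (proj : forall k, mor x (s k)),
    [/\ forall k, proj k ∘ inj k = idm (s k),
        forall k l, k != l -> proj l ∘ inj k = 0
      & \sum_k inj k ∘ proj k = idm x].

(* The case n = 0 of the first axiom provides a zero object. *)
Record abelian : Prop := Abelian {
  has_direct_sums : forall n (s : 'I_n -> C), exists x, is_direct_sum s x;
  has_kernels : forall x y (f : mor x y),
    exists z (k : mor z x), is_kernel f k;
  has_cokernels : forall x y (f : mor x y),
    exists z (q : mor y z), is_cokernel f q;
  mono_normal : forall x y (m : mor x y), mono m ->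
    exists z (f : mor y z), is_kernel f m;
  epi_normal : forall x y (e : mor x y), epi e ->
    exists z (f : mor z x), is_cokernel f e
}.

Definition simple x : Prop :=
  ~ is_zero x /\ forall z (m : mor z x), mono m -> is_zero z \/ is_iso m.

Definition semisimple : Prop :=
  forall x, exists n (s : 'I_n -> C),
    (forall k, simple (s k)) /\ is_direct_sum s x.

End AbelianCategories.

Record monoidalCategory (K : fieldType) := MonoidalCategory {
  mon_cat :> linCategory K;
  tens : mon_cat -> mon_cat -> mon_cat;
  tensm : forall x x' y y' : mon_cat,
    mor x x' -> mor y y' -> mor (tens x y) (tens x' y');
  one : mon_cat;
  assoc : forall x y z, iso (tens (tens x y) z) (tens x (tens y z));
  lunit : forall x, iso (tens one x) x;
  runit : forall x, iso (tens x one) x;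
  tensm_id : forall x y, tensm (idm x) (idm y) = idm (tens x y);
  tensm_comp : forall x x' x'' y y' y'' (f' : mor x' x'') (f : mor x x')
      (g' : mor y' y'') (g : mor y y'),
    tensm (f' ∘ f) (g' ∘ g) = tensm f' g' ∘ tensm f g;
  tensm_linl : forall x x' y y' (g : mor y y'),
    linear (fun f : mor x x' => tensm f g);
  tensm_linr : forall x x' y y' (f : mor x x'),
    linear (fun g : mor y y' => tensm f g);
  assoc_nat : forall x x' y y' z z' (f : mor x x') (g : mor y y')
      (h : mor z z'),
    assoc x' y' z' ∘ tensm (tensm f g) h = tensm f (tensm g h) ∘ assoc x y z;
  lunit_nat : forall x y (f : mor x y),
    lunit y ∘ tensm (idm one) f = f ∘ lunit x;
  runit_nat : forall x y (f : mor x y),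
    runit y ∘ tensm f (idm one) = f ∘ runit x;
  pentagon : forall x y z t,
    assoc x y (tens z t) ∘ assoc (tens x y) z t =
    tensm (idm x) (assoc y z t) ∘ assoc x (tens y z) t
      ∘ tensm (assoc x y z) (idm t);
  triangle : forall x y,
    tensm (idm x) (lunit y) ∘ assoc x one y = tensm (runit x) (idm y)
}.
Arguments tens {K m} x y.
Arguments tensm {K m x x' y y'} f g.
Arguments one {K m}.
Arguments assoc {K m} x y z.
Arguments lunit {K m} x.
Arguments runit {K m} x.

Notation "x ⊗ y" := (tens x y) (at level 38, left associativity) : cat_scope.
Notation "f ⊠ g" := (tensm f g) (at level 38, left associativity) : cat_scope.

(* Both hexagons are needed: the braiding is not assumed symmetric. *)
Record braidedCategory (K : fieldType) := BraidedCategory {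
  br_cat :> monoidalCategory K;
  braid : forall x y : br_cat, iso (x ⊗ y) (y ⊗ x);
  braid_nat : forall (x x' y y' : br_cat) (f : mor x x') (g : mor y y'),
    braid x' y' ∘ (f ⊠ g) = (g ⊠ f) ∘ braid x y;
  hexagon1 : forall x y z : br_cat,
    assoc y z x ∘ braid x (y ⊗ z) ∘ assoc x y z =
    (idm y ⊠ braid x z) ∘ assoc y x z ∘ (braid x y ⊠ idm z);
  hexagon2 : forall x y z : br_cat,
    isoinv (assoc z x y) ∘ braid (x ⊗ y) z ∘ isoinv (assoc x y z) =
    (braid x z ⊠ idm y) ∘ isoinv (assoc x z y) ∘ (idm x ⊠ braid y z)
}.
Arguments braid {K b} x y.

(* Ribbon categories in the sense of Turaev: a braided category with left
   duals (which are also right duals, thanks to the braiding) and a twist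
   compatible with duality; [twist_dual] says that the twist of the dual of x
   is the transpose of the twist of x. *)
Record ribbonCategory (K : fieldType) := RibbonCategory {
  rib_cat :> braidedCategory K;
  dual : rib_cat -> rib_cat;
  ev : forall x, mor (dual x ⊗ x) one;
  coev : forall x, mor one (x ⊗ dual x);
  zigzag1 : forall x,
    runit x ∘ (idm x ⊠ ev x) ∘ assoc x (dual x) x ∘ (coev x ⊠ idm x) = lunit x;
  zigzag2 : forall x,
    lunit (dual x) ∘ (ev x ⊠ idm (dual x)) ∘ isoinv (assoc (dual x) x (dual x))
      ∘ (idm (dual x) ⊠ coev x) = runit (dual x);
  twist : forall x : rib_cat, iso x x;
  twist_nat : forall (x y : rib_cat) (f : mor x y),
    twist y ∘ f = f ∘ twist x;
  twist_tens : forall x y : rib_cat,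
    twist (x ⊗ y) = braid y x ∘ braid x y ∘ (twist x ⊠ twist y) :> mor _ _;
  twist_dual : forall x : rib_cat,
    (twist x ⊠ idm (dual x)) ∘ coev x = (idm x ⊠ twist (dual x)) ∘ coev x
}.
Arguments dual {K r} x.
Arguments ev {K r} x.
Arguments coev {K r} x.
Arguments twist {K r} x.

Section Trace.
Variables (K : fieldType) (C : ribbonCategory K).

(* [scalar_of f] is the coordinate of f on the basis idm one of End(1): when
   the unit object is simple and K is algebraically closed, this
   is the scalar a such that f = a *: idm one. *)
Definition scalar_of (f : mor (one : C) one) : K :=
  coord [tuple idm (one : C)] ord0 f.

Definition qtrace (x : C) (f : mor x x) : K :=
  scalar_of (ev x ∘ braid x (dual x) ∘ ((twist x ∘ f) ⊠ idm (dual x)) ∘ coev x).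

Definition qdim (x : C) : K := qtrace (idm x).

(* The invariant of the Hopf link coloured by x and y. *)
Definition hopf (x y : C) : K := qtrace (braid y x ∘ braid x y).

(* x_1 ⊗ (x_2 ⊗ (... ⊗ x_n)), and the unit object if n = 0. *)
Fixpoint tens_seq (s : seq C) : C :=
  match s with
  | [::] => one
  | [:: x] => x
  | x :: s' => x ⊗ tens_seq s'
  end.

End Trace.

(* K is, e.g., the field of complex numbers (or of algebraic numbers). The type
   [irr] indexes a set of representatives of the isomorphism classes of simple
   objects; [rep irr0] is only required to be isomorphic to the unit. The last
   axiom is the invertibility of the unnormalized S-matrix, with rows and
   columns numbered through the enumeration of [irr]. *)
Record modularCategory (K : numClosedFieldType) := ModularCategory {
  mod_cat :> ribbonCategory K;
  mod_abelian : abelian mod_cat;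
  mod_semisimple : semisimple mod_cat;
  irr : finType;
  rep : irr -> mod_cat;
  rep_simple : forall i, simple (rep i);
  rep_surj : forall x, simple x -> exists i, isomorphic x (rep i);
  rep_inj : forall i j, isomorphic (rep i) (rep j) -> i = j;
  irr0 : irr;
  rep_irr0 : isomorphic (rep irr0) one;
  hopf_nondegenerate :
    \matrix_(i < #|irr|, j < #|irr|)
      hopf (rep (enum_val i)) (rep (enum_val j)) \in unitmx
}.
Arguments irr {K} m.
Arguments rep {K m} i.
Arguments irr0 {K} m.

Section ModularData.
Variables (K : numClosedFieldType) (C : modularCategory K).

Definition globaldim : K := \sum_(i : irr C) qdim (rep i) ^+ 2.

(* For K the complex numbers, dividing by the positive square root of the global
   dimension is the normalization making S unitary. *)
Definition Smatrix (i j : irr C) : K := hopf (rep i) (rep j) / sqrtC globaldim.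

Definition Bl n (p : 'I_n -> irr C) : vectType K :=
  dsum (fun i : irr C =>
    mor (tens_seq [seq rep (p a) | a <- enum 'I_n]) (rep i ⊗ dual (rep i))).

End ModularData.

(* Main.v *)
(* dim Bl(p) is the trace of the fusion matrix of P = p_1 ⊗ ... ⊗ p_n, since
   Hom(P, i ⊗ dual i) = Hom(i ⊗ P, i). For j simple, pulling a loop coloured by x
   off a strand coloured by j multiplies by chi_j(x) = hopf x j / qdim j, which
   is multiplicative in x; hence the columns of the Hopf matrix are common
   eigenvectors of the fusion matrices, with eigenvalues chi_j(x), and the trace
   is \sum_j chi_j(P) = \sum_j \prod_a chi_j(p_a).
     The normalization of S cancels because the global dimension is nonzero. Let
   v_j = \sum_i d_i s_ij. Then (chi_j(k) - qdim (dual k)) v_j = 0 for all k, where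
   qdim (dual k) = d_k by compatibility of twist and duality; as the columns j <> 0
   of s are not proportional to column 0, v is supported at 0, with v_0 the
   global dimension, and v <> 0 because s is invertible. *)
From HB Require Import structures.
From mathcomp Require Import all_boot all_order all_algebra.
Require Import Defs.

Set Implicit Arguments.
Unset Strict Implicit.
Unset Printing Implicit Defensive.

Import GRing.Theory Num.Theory.
Local Open Scope ring_scope.
Local Open Scope cat_scope.

Local Notation "x ◁ f" := (tensm (idm x) f)
  (at level 37, right associativity) : cat_scope.
Local Notation "f ▷ z" := (tensm f (idm z))
  (at level 38, left associativity) : cat_scope.

(** * Linear and monoidal categories *)

Section LinearFunctions.
Variables (K : fieldType) (U V : lmodType K) (f : U -> V).
Hypothesis f_lin : linear f.

HB.instance Definition _ := GRing.isLinear.Build K U V *:%R f f_lin.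

Lemma lin_fun0 : f 0 = 0. Proof. exact: linear0. Qed.
Lemma lin_funB : {morph f : u v / u - v}. Proof. exact: linearB. Qed.
Lemma lin_funZ a : {morph f : u / a *: u}. Proof. exact: linearZ. Qed.
Lemma lin_fun_sum (I : finType) (E : I -> U) :
  f (\sum_i E i) = \sum_i f (E i).
Proof. exact: linear_sum. Qed.

End LinearFunctions.

Section Composition.
Variables (K : fieldType) (C : linCategory K).
Implicit Types x y z t : C.

(** Composites are kept nested to the left; [comp2], [comp3] and [comp4] rewrite consecutive inner
    factors of such a chain without moving its brackets by hand. *)
Lemma comp2 x y z t (f : mor y z) (g : mor x y) r (k : mor z t) :
  f ∘ g = r -> k ∘ f ∘ g = k ∘ r.
Proof. by move=> <-; rewrite compA. Qed.

Lemma comp3 x y z t u (f : mor y z) (g : mor x y) (h : mor u x) r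
    (k : mor z t) :
  f ∘ g ∘ h = r -> k ∘ f ∘ g ∘ h = k ∘ r.
Proof. by move=> <-; rewrite !compA. Qed.

Lemma comp4 x y z t u v (f : mor y z) (g : mor x y) (h : mor u x)
    (i : mor v u) r (k : mor z t) :
  f ∘ g ∘ h ∘ i = r -> k ∘ f ∘ g ∘ h ∘ i = k ∘ r.
Proof. by move=> <-; rewrite !compA. Qed.

Lemma isoKc x y z (i : iso x y) (f : mor x z) : f ∘ isoinv i ∘ i = f.
Proof. by rewrite (comp2 _ (isoK i)) compm1. Qed.

Lemma isoinvKc x y z (i : iso x y) (f : mor y z) : f ∘ i ∘ isoinv i = f.
Proof. by rewrite (comp2 _ (isoinvK i)) compm1. Qed.

Lemma iso_epi x y z (i : iso x y) (f g : mor y z) : f ∘ i = g ∘ i -> f = g.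
Proof. by move=> e; rewrite -(isoinvKc i f) e isoinvKc. Qed.

Lemma isoinv_epi x y z (i : iso x y) (f g : mor x z) :
  f ∘ isoinv i = g ∘ isoinv i -> f = g.
Proof. by move=> e; rewrite -(isoKc i f) e isoKc. Qed.

Lemma iso_mono x y z (i : iso x y) (f g : mor z x) : i ∘ f = i ∘ g -> f = g.
Proof.
by move=> e; rewrite -[f]comp1m -(isoK i) -compA e compA isoK comp1m.
Qed.

Lemma isoinv_eq x y (i j : iso x y) : i = j :> mor x y -> isoinv i = isoinv j.
Proof. by move=> e; apply: (iso_epi (i := i)); rewrite isoK e isoK. Qed.

Lemma comp0m x y z (g : mor x y) : (0 : mor y z) ∘ g = 0.
Proof. exact: (lin_fun0 (@comp_linl _ _ _ _ z g)). Qed.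

Lemma compm0 x y z (f : mor y z) : f ∘ (0 : mor x y) = 0.
Proof. exact: (lin_fun0 (@comp_linr _ _ x _ _ f)). Qed.

Lemma compmB x y z (f : mor y z) (g g' : mor x y) :
  f ∘ (g - g') = f ∘ g - f ∘ g'.
Proof. exact: (lin_funB (@comp_linr _ _ x _ _ f)). Qed.

Lemma compZm x y z a (f : mor y z) (g : mor x y) :
  (a *: f) ∘ g = a *: (f ∘ g).
Proof. exact: (lin_funZ (@comp_linl _ _ _ _ z g)). Qed.

Lemma compmZ x y z a (f : mor y z) (g : mor x y) :
  f ∘ (a *: g) = a *: (f ∘ g).
Proof. exact: (lin_funZ (@comp_linr _ _ x _ _ f)). Qed.

Lemma comp_suml x y z (I : finType) (E : I -> mor y z) (g : mor x y) :
  (\sum_i E i) ∘ g = \sum_i (E i ∘ g).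
Proof. exact: (lin_fun_sum (@comp_linl _ _ _ _ z g)). Qed.

Lemma comp_sumr x y z (I : finType) (f : mor y z) (E : I -> mor x y) :
  f ∘ (\sum_i E i) = \sum_i (f ∘ E i).
Proof. exact: (lin_fun_sum (@comp_linr _ _ x _ _ f)). Qed.

Definition iso_sym x y (i : iso x y) : iso y x := Iso (isoinvK i) (isoK i).

Lemma iso_comp_subproof x y z (i : iso y z) (j : iso x y) :
  isoinv j ∘ isoinv i ∘ (i ∘ j) = idm x /\
  i ∘ j ∘ (isoinv j ∘ isoinv i) = idm z.
Proof. by rewrite !compA isoKc isoK isoinvKc isoinvK. Qed.

Definition iso_comp x y z (i : iso y z) (j : iso x y) : iso x z :=
  Iso (iso_comp_subproof i j).1 (iso_comp_subproof i j).2.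

End Composition.

Section Monoidal.
Variables (K : fieldType) (C : monoidalCategory K).
Implicit Types x y z t u w a b : C.

Lemma whiskZ x y z (a : K) (f : mor y z) : x ◁ (a *: f) = a *: (x ◁ f).
Proof. exact: (lin_funZ (@tensm_linr _ _ _ _ y z (idm x))). Qed.

Lemma Zwhisk x y z (a : K) (f : mor y z) : (a *: f) ▷ x = a *: (f ▷ x).
Proof. exact: (lin_funZ (@tensm_linl _ _ y z _ _ (idm x))). Qed.

Lemma sum_whisk x y z (I : finType) (E : I -> mor y z) :
  (\sum_i E i) ▷ x = \sum_i (E i ▷ x).
Proof. exact: (lin_fun_sum (@tensm_linl _ _ y z _ _ (idm x))). Qed.

Lemma whisk_comp x y z t (f : mor z t) (g : mor y z) :
  x ◁ (f ∘ g) = (x ◁ f) ∘ (x ◁ g).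
Proof. by rewrite -tensm_comp comp1m. Qed.

Lemma comp_whisk x y z t (f : mor z t) (g : mor y z) :
  (f ∘ g) ▷ x = (f ▷ x) ∘ (g ▷ x).
Proof. by rewrite -tensm_comp comp1m. Qed.

Lemma whisk_exch x x' y y' (f : mor x x') (g : mor y y') :
  (f ▷ y') ∘ (x ◁ g) = (x' ◁ g) ∘ (f ▷ y).
Proof. by rewrite -!tensm_comp !(comp1m, compm1). Qed.

Lemma whisk_iso_subproof x y z (i : iso y z) :
  (x ◁ isoinv i) ∘ (x ◁ i) = idm _ /\ (x ◁ i) ∘ (x ◁ isoinv i) = idm _.
Proof. by rewrite -!whisk_comp isoK isoinvK !tensm_id. Qed.

Definition whisk_iso x y z (i : iso y z) : iso (x ⊗ y) (x ⊗ z) :=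
  Iso (whisk_iso_subproof x i).1 (whisk_iso_subproof x i).2.

Lemma iso_whisk_subproof x y z (i : iso y z) :
  (isoinv i ▷ x) ∘ (i ▷ x) = idm _ /\ (i ▷ x) ∘ (isoinv i ▷ x) = idm _.
Proof. by rewrite -!comp_whisk isoK isoinvK !tensm_id. Qed.

Definition iso_whisk x y z (i : iso y z) : iso (y ⊗ x) (z ⊗ x) :=
  Iso (iso_whisk_subproof x i).1 (iso_whisk_subproof x i).2.

Lemma assocV_nat x x' y y' z z' (f : mor x x') (g : mor y y') (h : mor z z') :
  isoinv (assoc x' y' z') ∘ (f ⊠ (g ⊠ h)) =
  f ⊠ g ⊠ h ∘ isoinv (assoc x y z).
Proof.
apply: (iso_epi (i := assoc x y z)); apply: (iso_mono (i := assoc x' y' z')).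
by rewrite isoKc !compA isoinvK comp1m assoc_nat.
Qed.

Lemma whisk_faithful y z (f g : mor y z) : one ◁ f = one ◁ g -> f = g.
Proof.
by move=> e; apply: (iso_epi (i := lunit y)); rewrite -!lunit_nat e.
Qed.

Lemma faithful_whisk y z (f g : mor y z) : f ▷ one = g ▷ one -> f = g.
Proof.
by move=> e; apply: (iso_epi (i := runit y)); rewrite -!runit_nat e.
Qed.

Lemma whisk_whisk x y z t (f : mor z t) :
  assoc x y t ∘ ((x ⊗ y) ◁ f) = x ◁ (y ◁ f) ∘ assoc x y z.
Proof. by rewrite -assoc_nat tensm_id. Qed.

Lemma whisk_whiskr x y z t (f : mor x y) :
  assoc y z t ∘ (f ▷ z ▷ t) = f ▷ (z ⊗ t) ∘ assoc x z t.
Proof. by rewrite assoc_nat tensm_id. Qed.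

Lemma whisk_whiskV x y z t (f : mor z t) :
  isoinv (assoc x y t) ∘ (x ◁ (y ◁ f)) =
  ((x ⊗ y) ◁ f) ∘ isoinv (assoc x y z).
Proof. by rewrite assocV_nat tensm_id. Qed.

Lemma whisk_whiskrV x y z t (f : mor x y) :
  isoinv (assoc y z t) ∘ (f ▷ (z ⊗ t)) =
  (f ▷ z ▷ t) ∘ isoinv (assoc x z t).
Proof. by rewrite -assocV_nat tensm_id. Qed.

(** Kelly's argument: tensoring with the unit on the left loses nothing, and after it the identity
    follows from the pentagon and two triangles. *)
Lemma lunit_tens x y : lunit (x ⊗ y) ∘ assoc one x y = lunit x ▷ y.
Proof.
apply: whisk_faithful; rewrite whisk_comp.
apply: (iso_epi (i := assoc one (one ⊗ x) y)).
apply: (iso_epi (i := iso_whisk y (assoc one one x))); rewrite /=.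
rewrite -!compA [X in _ ∘ X]compA -pentagon compA.
by rewrite triangle -whisk_whiskr -triangle comp_whisk !compA assoc_nat.
Qed.

Lemma runit_tens x y : (x ◁ runit y) ∘ assoc x y one = runit (x ⊗ y).
Proof.
apply: faithful_whisk; rewrite comp_whisk.
apply: (iso_mono (i := assoc x y one)).
rewrite -[in RHS]triangle !compA assoc_nat -triangle whisk_comp whisk_whisk.
by rewrite (comp2 _ (pentagon _ _ _ _)) !compA.
Qed.

(* The diagrammatic calculus is carried out on families indexed by an object z
   tensored on the far right, all products being nested to the right: in this
   form associators disappear. The bodies are locked because [rewrite compA]
   would otherwise unfold them. *)
Definition cap a b (e : mor (a ⊗ b) one) z : mor (a ⊗ (b ⊗ z)) z :=
  locked (lunit z ∘ (e ▷ z) ∘ isoinv (assoc a b z)).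

Definition cup a b (k : mor one (a ⊗ b)) z : mor z (a ⊗ (b ⊗ z)) :=
  locked (assoc a b z ∘ (k ▷ z) ∘ isoinv (lunit z)).

Lemma capE a b (e : mor (a ⊗ b) one) z :
  cap e z = lunit z ∘ (e ▷ z) ∘ isoinv (assoc a b z).
Proof. by rewrite /cap -lock. Qed.

Lemma cupE a b (k : mor one (a ⊗ b)) z :
  cup k z = assoc a b z ∘ (k ▷ z) ∘ isoinv (lunit z).
Proof. by rewrite /cup -lock. Qed.

End Monoidal.

(** * Caps and cups in right-nested products *)

Section MonoidalHats.
Variables (K : fieldType) (C : monoidalCategory K).
Implicit Types x y z t u w a b : C.

Lemma cap_nat a b (e : mor (a ⊗ b) one) y z (f : mor y z) :
  cap e z ∘ (a ◁ b ◁ f) = f ∘ cap e y.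
Proof.
rewrite !capE (comp2 _ (assocV_nat _ _ _)) tensm_id compA
  (comp2 _ (whisk_exch _ _)).
by rewrite !compA lunit_nat.
Qed.

Lemma lunitV_nat y z (f : mor y z) :
  isoinv (lunit z) ∘ f = (one ◁ f) ∘ isoinv (lunit y).
Proof.
apply: (iso_mono (i := lunit z)); apply: (iso_epi (i := lunit y)).
by rewrite !compA isoinvK comp1m isoKc lunit_nat.
Qed.

Lemma cup_nat a b (k : mor one (a ⊗ b)) y z (f : mor y z) :
  (a ◁ b ◁ f) ∘ cup k y = cup k z ∘ f.
Proof.
rewrite !cupE !compA -whisk_whisk (comp2 _ (lunitV_nat _)) compA.
by rewrite (comp2 _ (whisk_exch _ _)) compA.
Qed.

Lemma cap_whiskl a a' b (e : mor (a' ⊗ b) one) (f : mor a a') z :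
  cap (e ∘ (f ▷ b)) z = cap e z ∘ (f ▷ (b ⊗ z)).
Proof.
by rewrite !capE comp_whisk -!compA -tensm_id assocV_nat.
Qed.

Lemma cup_whiskl a a' b (k : mor one (a ⊗ b)) (f : mor a a') z :
  cup ((f ▷ b) ∘ k) z = (f ▷ (b ⊗ z)) ∘ cup k z.
Proof.
by rewrite !cupE comp_whisk !compA whisk_whiskr.
Qed.

Lemma cup_whiskr a b b' (k : mor one (a ⊗ b)) (f : mor b b') z :
  cup ((a ◁ f) ∘ k) z = (a ◁ (f ▷ z)) ∘ cup k z.
Proof.
by rewrite !cupE comp_whisk !compA assoc_nat.
Qed.

Lemma pentagonV x y z t :
  (x ◁ isoinv (assoc y z t)) ∘ assoc x y (z ⊗ t) =
  assoc x (y ⊗ z) t ∘ (assoc x y z ▷ t) ∘ isoinv (assoc (x ⊗ y) z t).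
Proof.
apply: (iso_mono (i := whisk_iso x (assoc y z t))) => /=.
apply: (iso_epi (i := assoc (x ⊗ y) z t)).
by rewrite !compA isoKc -whisk_comp isoinvK tensm_id comp1m pentagon.
Qed.

Lemma pentagonVV x y z t :
  isoinv (assoc x y (z ⊗ t)) ∘ (x ◁ assoc y z t) =
  assoc (x ⊗ y) z t ∘ (isoinv (assoc x y z) ▷ t)
    ∘ isoinv (assoc x (y ⊗ z) t).
Proof.
apply: (iso_mono (i := assoc x y (z ⊗ t))).
apply: (iso_epi (i := assoc x (y ⊗ z) t)).
rewrite !compA isoinvK comp1m isoKc pentagon.
by rewrite -compA -comp_whisk isoinvK tensm_id compm1.
Qed.

(** A cap acts on its own two strands only, so its value at [z ⊗ u] is already determined by its
    value at [z]. *)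
Lemma cap_tens a b (e : mor (a ⊗ b) one) z u :
  cap e (z ⊗ u) ∘ (a ◁ assoc b z u) ∘ assoc a (b ⊗ z) u = cap e z ▷ u.
Proof.
rewrite !capE (comp2 _ (pentagonVV _ _ _ _)) !compA isoKc.
rewrite -tensm_id (comp2 _ (esym (assoc_nat _ _ _))) compA.
by rewrite lunit_tens -!comp_whisk.
Qed.

Lemma lunitV_tens x y :
  assoc one x y ∘ (isoinv (lunit x) ▷ y) = isoinv (lunit (x ⊗ y)).
Proof.
apply: (iso_mono (i := lunit (x ⊗ y))).
by rewrite compA lunit_tens isoinvK -comp_whisk isoinvK tensm_id.
Qed.

Lemma cup_tens a b (k : mor one (a ⊗ b)) z u :
  (a ◁ assoc b z u) ∘ assoc a (b ⊗ z) u ∘ (cup k z ▷ u) = cup k (z ⊗ u).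
Proof.
rewrite !cupE !comp_whisk !compA -pentagon.
rewrite (comp2 _ (whisk_whiskr _ _ _)) compA.
by rewrite (comp2 _ (lunitV_tens _ _)).
Qed.

End MonoidalHats.

(** * Braidings *)

Section Braided.
Variables (K : fieldType) (C : braidedCategory K).
Implicit Types x y z t u w a b : C.

(** The hexagon with two units relates [braid x one] to its own whiskering; cancelling one copy of
    the braiding leaves the unit law. *)
Lemma braid_lunit x : lunit x ∘ braid x one = runit x.
Proof.
apply: faithful_whisk; apply: (iso_mono (i := braid x one)).
rewrite comp_whisk compA -(lunit_tens x one).
have := hexagon1 x one one => /(congr1 (fun f => lunit _ ∘ f)).
rewrite !compA lunit_tens lunit_nat -braid_nat (comp2 _ (triangle _ _)).
by move=> ->.
Qed.

Lemma triangleV x y : (runit x ▷ y) ∘ isoinv (assoc x one y) = x ◁ lunit y.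
Proof. by rewrite -triangle isoinvKc. Qed.

Lemma runit_tensV x y :
  runit (x ⊗ y) ∘ isoinv (assoc x y one) = x ◁ runit y.
Proof. by rewrite -runit_tens isoinvKc. Qed.

Lemma braid_runit x : runit x ∘ braid one x = lunit x.
Proof.
apply: whisk_faithful; apply: (iso_mono (i := braid one x)).
rewrite whisk_comp compA -(runit_tensV one x).
have := hexagon2 one one x => /(congr1 (fun f => runit _ ∘ f)).
rewrite !compA runit_tensV runit_nat -braid_nat (comp2 _ (triangleV _ _)).
by move=> ->.
Qed.
End Braided.

(** * Crossings of neighbouring strands in right-nested products *)

Section BraidedHats.
Variables (K : fieldType) (C : braidedCategory K).
Implicit Types x y z t u w a b : C.

Definition cross_iso x y z : iso (x ⊗ (y ⊗ z)) (y ⊗ (x ⊗ z)) :=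
  iso_comp (assoc y x z)
    (iso_comp (iso_whisk z (braid x y)) (iso_sym (assoc x y z))).

Definition cross x y z : mor (x ⊗ (y ⊗ z)) (y ⊗ (x ⊗ z)) :=
  locked (isom (cross_iso x y z)).
Definition crossV x y z : mor (y ⊗ (x ⊗ z)) (x ⊗ (y ⊗ z)) :=
  locked (isoinv (cross_iso x y z)).

Lemma crossE x y z :
  cross x y z = assoc y x z ∘ (braid x y ▷ z) ∘ isoinv (assoc x y z).
Proof. by rewrite /cross -lock /= compA. Qed.

Lemma crossK x y z : crossV x y z ∘ cross x y z = idm _.
Proof. rewrite /cross /crossV -!lock; exact: isoK. Qed.

Lemma crossVK x y z : cross x y z ∘ crossV x y z = idm _.
Proof. rewrite /cross /crossV -!lock; exact: isoinvK. Qed.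

Lemma cross_nat x y z t (f : mor z t) :
  cross x y t ∘ (x ◁ y ◁ f) = (y ◁ x ◁ f) ∘ cross x y z.
Proof.
rewrite !crossE (comp2 _ (assocV_nat _ _ _)) tensm_id compA.
by rewrite (comp2 _ (whisk_exch _ _)) !compA whisk_whisk.
Qed.

Lemma cross_natl x x' y z (f : mor x x') :
  cross x' y z ∘ (f ▷ (y ⊗ z)) = (y ◁ (f ▷ z)) ∘ cross x y z.
Proof.
rewrite !crossE -[idm (y ⊗ z)]tensm_id (comp2 _ (assocV_nat _ _ _)) !compA.
by rewrite -assoc_nat -(compA _ (_ ▷ z) (_ ▷ z)) -comp_whisk braid_nat
  comp_whisk compA.
Qed.

Lemma cross_natr x y y' z (f : mor y y') :
  cross x y' z ∘ (x ◁ (f ▷ z)) = (f ▷ (x ⊗ z)) ∘ cross x y z.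
Proof.
rewrite !crossE (comp2 _ (assocV_nat _ _ _)) !compA -[idm (x ⊗ z)]tensm_id.
by rewrite -assoc_nat -(compA _ (_ ▷ z) (_ ▷ z)) -comp_whisk braid_nat
  comp_whisk compA.
Qed.

Lemma hexagon1' x y z :
  assoc y z x ∘ braid x (y ⊗ z) =
  (y ◁ braid x z) ∘ assoc y x z ∘ (braid x y ▷ z) ∘ isoinv (assoc x y z).
Proof. by apply: (iso_epi (i := assoc x y z)); rewrite isoKc hexagon1. Qed.

Lemma hexagon2' x y z :
  isom (braid (x ⊗ y) z) =
  assoc z x y ∘ (braid x z ▷ y) ∘ isoinv (assoc x z y) ∘ (x ◁ braid y z)
    ∘ assoc x y z.
Proof.
apply: (isoinv_epi (i := assoc x y z)).
apply: (iso_mono (i := iso_sym (assoc z x y))).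
by rewrite /= isoinvKc !compA isoK comp1m hexagon2.
Qed.

(** The first hexagon for families; [cross_tensl] is the second. *)
Lemma cross_tensr x y y' z :
  assoc y y' (x ⊗ z) ∘ cross x (y ⊗ y') z =
  (y ◁ cross x y' z) ∘ cross x y (y' ⊗ z) ∘ (x ◁ assoc y y' z).
Proof.
rewrite !crossE !compA !whisk_comp (comp2 _ (pentagonVV _ _ _ _)) !compA.
rewrite (comp2 _ (pentagonV _ _ _ _)) !compA (comp2 _ (whisk_whiskrV _ _ _)).
rewrite !compA isoKc pentagon -(compA _ (_ ▷ z) (_ ▷ z)) -comp_whisk.
rewrite hexagon1' !comp_whisk !compA.
by rewrite (comp2 _ (assoc_nat _ _ _)) !compA.
Qed.

Lemma cross_tensl x x' y z :
  (y ◁ assoc x x' z) ∘ cross (x ⊗ x') y z =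
  cross x y (x' ⊗ z) ∘ (x ◁ cross x' y z) ∘ assoc x x' (y ⊗ z).
Proof.
rewrite !crossE !compA !whisk_comp !compA.
rewrite [in RHS](comp2 _ (pentagonVV _ _ _ _)) !compA.
rewrite hexagon2' !comp_whisk !compA.
rewrite (comp2 _ (assocV_nat _ _ _)) !compA (comp2 _ (pentagonV _ _ _ _))
  !compA.
by rewrite isoKc (comp2 _ (esym (whisk_whiskr _ _ _))) !compA pentagon.
Qed.

Lemma cross_lunit y z : lunit (y ⊗ z) ∘ cross y one z = y ◁ lunit z.
Proof.
by rewrite crossE !compA lunit_tens -comp_whisk braid_lunit triangleV.
Qed.

Lemma cross_runit y z : (y ◁ lunit z) ∘ cross one y z = lunit (y ⊗ z).
Proof.
by rewrite crossE !compA triangle -comp_whisk braid_runit -lunit_tens isoinvKc.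
Qed.

Lemma cross_lunitV y z :
  cross y one z ∘ (y ◁ isoinv (lunit z)) = isoinv (lunit (y ⊗ z)).
Proof.
apply: (iso_mono (i := lunit (y ⊗ z))).
by rewrite compA cross_lunit -whisk_comp !isoinvK tensm_id.
Qed.

Lemma cross_runitV y z :
  cross one y z ∘ isoinv (lunit (y ⊗ z)) = y ◁ isoinv (lunit z).
Proof.
apply: (iso_mono (i := whisk_iso y (lunit z))).
by rewrite /= compA cross_runit -whisk_comp !isoinvK tensm_id.
Qed.

Lemma cross_tensrV x y y' z :
  cross x (y ⊗ y') z ∘ (x ◁ isoinv (assoc y y' z)) =
  isoinv (assoc y y' (x ⊗ z)) ∘ (y ◁ cross x y' z) ∘ cross x y (y' ⊗ z).
Proof.
apply: (iso_epi (i := whisk_iso x (assoc y y' z))).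
apply: (iso_mono (i := assoc y y' (x ⊗ z))).
rewrite /= -(compA _ (x ◁ _)) -whisk_comp isoK tensm_id compm1.
by rewrite cross_tensr !compA isoinvK comp1m.
Qed.

(** The crossing of [y] with [a ⊗ b] is natural, so [e] can be pulled through it, and the remaining
    crossing with the unit is trivial. Graphically, a strand slides past a cap. *)
Lemma cap_crossr a b (e : mor (a ⊗ b) one) y z :
  cap e (y ⊗ z) ∘ (a ◁ cross y b z) ∘ cross y a (b ⊗ z) = y ◁ cap e z.
Proof.
rewrite !capE (comp3 _ (esym (cross_tensrV y a b z))).
rewrite !compA (comp2 _ (esym (cross_natr _ _ _))) !compA cross_lunit.
by rewrite -!whisk_comp.
Qed.

Lemma cap_crossl a b (e : mor (a ⊗ b) one) y z :
  (y ◁ cap e z) ∘ cross a y (b ⊗ z) ∘ (a ◁ cross b y z) = cap e (y ⊗ z).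
Proof.
apply: (iso_epi (i := assoc a b (y ⊗ z))).
rewrite (comp3 _ (esym (cross_tensl a b y z))) !capE !whisk_comp !compA.
rewrite (comp2 _ (esym (whisk_comp _ _ _))) isoK tensm_id compm1.
by rewrite (comp2 _ (esym (cross_natl _ _ _))) !compA cross_runit isoKc.
Qed.

Lemma cup_crossr a b (k : mor one (a ⊗ b)) y z :
  (a ◁ cross y b z) ∘ cross y a (b ⊗ z) ∘ (y ◁ cup k z) = cup k (y ⊗ z).
Proof.
rewrite !cupE !whisk_comp !compA -cross_tensr.
by rewrite (comp2 _ (cross_natr _ _ _)) !compA (comp2 _ (cross_lunitV _ _)).
Qed.

Lemma cup_crossl a b (k : mor one (a ⊗ b)) y z :
  cross a y (b ⊗ z) ∘ (a ◁ cross b y z) ∘ cup k (y ⊗ z) = y ◁ cup k z.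
Proof.
rewrite !cupE !whisk_comp !compA -cross_tensl.
by rewrite (comp2 _ (cross_natl _ _ _)) !compA (comp2 _ (cross_runitV _ _)).
Qed.

(** Naturality of the crossing of [x ⊗ y] with [t], applied to the braiding of [x] and [y]. *)
Lemma yang_baxter x y t z :
  cross y t (x ⊗ z) ∘ (y ◁ cross x t z) ∘ cross x y (t ⊗ z) =
  (t ◁ cross x y z) ∘ cross x t (y ⊗ z) ∘ (x ◁ cross y t z).
Proof.
apply: (iso_epi (i := assoc x y (t ⊗ z))).
rewrite (comp3 _ (esym (cross_tensl _ _ _ _))) !(crossE x y) !whisk_comp !compA.
rewrite isoKc (comp2 _ (esym (whisk_comp _ _ _))) isoK tensm_id compm1.
by rewrite -cross_tensl (comp2 _ (cross_natl _ _ _)) !compA.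
Qed.

Lemma crossVc x y z t (f : mor (x ⊗ (y ⊗ z)) t) :
  f ∘ crossV x y z ∘ cross x y z = f.
Proof. by rewrite (comp2 _ (crossK _ _ _)) compm1. Qed.

Lemma crossVKc x y z t (f : mor (y ⊗ (x ⊗ z)) t) :
  f ∘ cross x y z ∘ crossV x y z = f.
Proof. by rewrite (comp2 _ (crossVK _ _ _)) compm1. Qed.

Lemma whisk_crossVKc x y z t w (f : mor (w ⊗ (y ⊗ (x ⊗ z))) t) :
  f ∘ (w ◁ cross x y z) ∘ (w ◁ crossV x y z) = f.
Proof.
by rewrite (comp2 _ (esym (whisk_comp _ _ _))) crossVK tensm_id compm1.
Qed.

Lemma crossV_nat x y z t (f : mor z t) :
  crossV x y t ∘ (y ◁ x ◁ f) = (x ◁ y ◁ f) ∘ crossV x y z.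
Proof.
rewrite -[LHS](crossVKc (x := x) (y := y)).
by rewrite (comp2 _ (esym (cross_nat _ _ _))) !compA crossK comp1m.
Qed.

Definition crossI x y z := Iso (crossK x y z) (crossVK x y z).

Lemma yang_baxterV x y t z :
  crossV x y (t ⊗ z) ∘ (y ◁ crossV x t z) ∘ crossV y t (x ⊗ z) =
  (x ◁ crossV y t z) ∘ crossV x t (y ⊗ z) ∘ (t ◁ crossV x y z).
Proof.
(* The two sides are the inverses of the two sides of [yang_baxter]. *)
have := isoinv_eq (i := iso_comp (iso_comp (crossI y t (x ⊗ z))
    (whisk_iso y (crossI x t z))) (crossI x y (t ⊗ z)))
  (j := iso_comp (iso_comp (whisk_iso t (crossI x y z)) (crossI x t (y ⊗ z)))
    (whisk_iso x (crossI y t z))).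
by rewrite /= !compA; apply; apply: yang_baxter.
Qed.

Lemma cap_braid a b (e : mor (a ⊗ b) one) z :
  cap (e ∘ braid b a) z = cap e z ∘ cross b a z.
Proof. by rewrite !capE crossE comp_whisk !compA isoKc. Qed.

Lemma cap_crossV a b (e : mor (a ⊗ b) one) y z :
  (y ◁ cap e z) ∘ crossV y a (b ⊗ z) = cap e (y ⊗ z) ∘ (a ◁ cross y b z).
Proof. by rewrite -cap_crossr crossVKc. Qed.

Lemma cup_crossV a b (k : mor one (a ⊗ b)) y z :
  cup k (y ⊗ z) = (a ◁ crossV b y z) ∘ crossV a y (b ⊗ z) ∘ (y ◁ cup k z).
Proof.
rewrite -cup_crossl !compA crossVc -whisk_comp crossK tensm_id comp1m //.
Qed.

Lemma cross_tens x y z u :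
  cross x y (z ⊗ u) ∘ ((x ◁ assoc y z u) ∘ assoc x (y ⊗ z) u) =
  (y ◁ assoc x z u) ∘ assoc y (x ⊗ z) u ∘ (cross x y z ▷ u).
Proof.
rewrite !crossE !comp_whisk !compA -pentagon (comp2 _ (pentagonVV _ _ _ _))
  !compA.
by rewrite isoKc (comp2 _ (esym (whisk_whiskr _ _ _))) !compA.
Qed.

End BraidedHats.

(** * Duals and encircling *)

Section FamilyDuals.
Variables (K : fieldType) (C : ribbonCategory K).
Implicit Types x y z t u w j : C.

Definition ecap x z := cap (ev x) z.
Definition ecup x z := cup (coev x) z.

Lemma ecap_nat x z t (f : mor z t) :
  ecap x t ∘ (dual x ◁ x ◁ f) = f ∘ ecap x z.
Proof. exact: cap_nat. Qed.

Lemma ecup_nat x z t (f : mor z t) :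
  (x ◁ dual x ◁ f) ∘ ecup x z = ecup x t ∘ f.
Proof. exact: cup_nat. Qed.

Lemma ecap_cross x w z :
  ecap x (w ⊗ z) ∘ (dual x ◁ cross w x z) ∘ cross w (dual x) (x ⊗ z) =
  w ◁ ecap x z.
Proof. exact: cap_crossr. Qed.

Lemma ecupK x z : (x ◁ ecap x z) ∘ ecup x (x ⊗ z) = idm _.
Proof.
rewrite /ecap /ecup capE cupE !whisk_comp !compA (comp2 _ (pentagonV _ _ _ _))
  !compA.
rewrite (comp2 _ (whisk_whiskrV _ _ _)) !compA.
rewrite (comp2 _ (esym (assoc_nat _ _ _))) !compA triangle.
by rewrite -!comp_whisk zigzag1 -lunit_tens isoinvKc isoinvK.
Qed.

Lemma ecapK x z : ecap x (dual x ⊗ z) ∘ (dual x ◁ ecup x z) = idm _.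
Proof.
rewrite /ecap /ecup capE cupE !whisk_comp !compA (comp2 _ (pentagonVV _ _ _ _))
  !compA.
rewrite (comp2 _ (esym (whisk_whiskr _ _ _))) !compA lunit_tens.
rewrite (comp2 _ (assocV_nat _ _ _)) !compA.
by rewrite -!comp_whisk zigzag2 triangleV -whisk_comp isoinvK tensm_id.
Qed.

(* A left dual of y, given by families instead of an evaluation and a
   coevaluation so that the dual of x ⊗ y needs no associators. *)
Record hdual y := HDual {
  hobj : C;
  hcap : forall z, mor (hobj ⊗ (y ⊗ z)) z;
  hcup : forall z, mor z (y ⊗ (hobj ⊗ z));
  hcap_nat : forall z t (f : mor z t),
    hcap t ∘ (hobj ◁ y ◁ f) = f ∘ hcap z;
  hcup_nat : forall z t (f : mor z t),
    (y ◁ hobj ◁ f) ∘ hcup z = hcup t ∘ f;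
  hcupK : forall z, (y ◁ hcap z) ∘ hcup (y ⊗ z) = idm _;
  hcap_cross : forall w z,
    hcap (w ⊗ z) ∘ (hobj ◁ cross w y z) ∘ cross w hobj (y ⊗ z) = w ◁ hcap z
}.

(** The right evaluation, built from the left one with the braiding and the twist; closing a cup
    with it computes the quantum trace. *)
Definition hcapc y (D : hdual y) z : mor (y ⊗ (hobj D ⊗ z)) z :=
  locked (hcap D z ∘ cross y (hobj D) z ∘ (twist y ▷ (hobj D ⊗ z))).

Lemma hcapcE y (D : hdual y) z :
  hcapc D z = hcap D z ∘ cross y (hobj D) z ∘ (twist y ▷ (hobj D ⊗ z)).
Proof. by rewrite /hcapc -lock. Qed.

Definition hdual_dual x : hdual x :=
  HDual (@ecap_nat x) (@ecup_nat x) (ecupK x) (ecap_cross x).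

Lemma hcapc_nat y (D : hdual y) z t (f : mor z t) :
  hcapc D t ∘ (y ◁ hobj D ◁ f) = f ∘ hcapc D z.
Proof.
rewrite !hcapcE (comp2 _ (whisk_exch _ _)) compA.
by rewrite (comp2 _ (cross_nat _ _ _)) !compA hcap_nat.
Qed.

Section Transpose.
Variables (x y : C) (D : hdual y) (f : mor x y).

(** The mate of [f] under the two dualities; it serves to slide [f] around cups and caps. *)
Definition transp z : mor (hobj D ⊗ z) (dual x ⊗ z) :=
  hcap D (dual x ⊗ z) ∘ (hobj D ◁ (f ▷ (dual x ⊗ z))) ∘ (hobj D ◁ ecup x z).

Lemma transp_cup z :
  (f ▷ (dual x ⊗ z)) ∘ ecup x z = (y ◁ transp z) ∘ hcup D z.
Proof.
rewrite /transp -compA -whisk_comp whisk_comp (comp2 _ (hcup_nat _ _)).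
by rewrite compA hcupK comp1m.
Qed.

Lemma transp_cap z :
  ecap x z ∘ transp (x ⊗ z) = hcap D z ∘ (hobj D ◁ (f ▷ z)).
Proof.
rewrite /transp !compA -hcap_nat.
rewrite (comp2 _ (esym (whisk_comp _ (y ◁ _) _))) -whisk_exch whisk_comp compA.
by rewrite (comp2 _ (esym (whisk_comp _ _ _))) ecupK tensm_id compm1.
Qed.

(** The strand [w] slides past the cap by [hcap_cross] and past the cup by [cup_crossr]. *)
Lemma transp_cross w z :
  cross w (dual x) z ∘ (w ◁ transp z) = transp (w ⊗ z) ∘ cross w (hobj D) z.
Proof.
rewrite /transp !whisk_comp !compA.
rewrite -(hcap_cross D) !compA -hcap_nat.
rewrite (comp2 _ (cross_nat _ _ _)) compA (comp2 _ (cross_nat _ _ _)) compA.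
congr (_ ∘ _); rewrite -!compA -!whisk_comp; congr (_ ∘ (_ ◁ _)).
rewrite (whisk_comp w) !compA (comp2 _ (cross_natr _ _ _)) !compA -whisk_exch.
by rewrite -(compA _ (x ◁ _)) -(compA _ _ (w ◁ _)) cup_crossr.
Qed.

(** Follows from [transp_cap] and naturality of the twist. This sliding law makes traces cyclic and
    independent of the chosen dual. *)
Lemma transp_capc z :
  hcapc (hdual_dual x) z ∘ (x ◁ transp z) = hcapc D z ∘ (f ▷ (hobj D ⊗ z)).
Proof.
rewrite !hcapcE /= (comp2 _ (whisk_exch _ _)) compA
  (comp2 _ (transp_cross _ _)).
rewrite compA transp_cap (comp2 _ (esym (cross_natl _ _ _))) !compA.
by rewrite -!(compA _ (_ ▷ (hobj D ⊗ z))) -!comp_whisk twist_nat.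
Qed.

End Transpose.

(** Bridge from families to the definition of [qtrace]: a loop acts on [z] through the endomorphism
    of the unit that defines the trace. *)
Lemma capc_scalar x z (f : mor x x) :
  hcapc (hdual_dual x) z ∘ (f ▷ (dual x ⊗ z)) ∘ ecup x z =
  lunit z ∘ ((ev x ∘ braid x (dual x) ∘ ((twist x ∘ f) ▷ dual x) ∘ coev x) ▷ z)
    ∘ isoinv (lunit z).
Proof.
rewrite hcapcE /= /ecap -cap_braid -cap_whiskl -cap_whiskl /ecup capE cupE
  !compA.
by rewrite isoKc !comp_whisk !compA.
Qed.

(** * The left dual of a tensor product, by nested caps and cups *)

Lemma comp_hdual_cupK x y z :
  (x ⊗ y)
    ◁ (ecap y z ∘ (dual y ◁ ecap x (y ⊗ z)) ∘ (dual y ◁ dual x ◁ assoc x y z)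
        ∘ assoc (dual y) (dual x) ((x ⊗ y) ⊗ z))
  ∘ (isoinv (assoc x y ((dual y ⊗ dual x) ⊗ ((x ⊗ y) ⊗ z)))
    ∘ (x ◁ y ◁ isoinv (assoc (dual y) (dual x) ((x ⊗ y) ⊗ z)))
    ∘ (x ◁ ecup y (dual x ⊗ ((x ⊗ y) ⊗ z))) ∘ ecup x ((x ⊗ y) ⊗ z)) = idm _.
Proof.
rewrite !compA -whisk_whiskV.
rewrite -(compA _ (x ◁ _) (x ◁ _)) -whisk_comp -(compA _ (x ◁ _) (x ◁ _)).
rewrite -whisk_comp compA -whisk_comp isoinvKc -!(compA (ecap y z)) -whisk_comp.
(* The zigzag of [y] is straightened first, then that of [x]. *)
rewrite (whisk_comp y) (comp2 _ (ecup_nat _ _)) compA ecupK comp1m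
  (whisk_comp x) compA.
by rewrite (comp2 _ (ecup_nat _ _)) compA (comp2 _ (ecupK _ _)) compm1 isoK.
Qed.

Lemma comp_hdual_cross x y w z :
  let cap z :=
    ecap y z ∘ (dual y ◁ ecap x (y ⊗ z)) ∘ (dual y ◁ dual x ◁ assoc x y z)
      ∘ assoc (dual y) (dual x) ((x ⊗ y) ⊗ z) in
  cap (w ⊗ z) ∘ ((dual y ⊗ dual x) ◁ cross w (x ⊗ y) z)
    ∘ cross w (dual y ⊗ dual x) ((x ⊗ y) ⊗ z) = w ◁ cap z.
Proof.
rewrite /= (comp2 _ (whisk_whisk _ _ _)) compA (comp2 _ (cross_tensr _ _ _ _))
  !compA.
(* The strand [w] first slides past the inner cap, that of [x]; the outer one is handled at the end
   by the same move. *)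
have slide : ecap x (y ⊗ (w ⊗ z)) ∘ (dual x ◁ assoc x y (w ⊗ z))
    ∘ (dual x ◁ cross w (x ⊗ y) z) ∘ cross w (dual x) ((x ⊗ y) ⊗ z) =
    cross w y z ∘ (w ◁ ecap x (y ⊗ z)) ∘ (w ◁ dual x ◁ assoc x y z).
  rewrite (comp2 _ (esym (whisk_comp _ _ _))) cross_tensr
    !(whisk_comp (dual x)) !compA.
  rewrite ecap_nat (comp2 _ (esym (cross_nat _ _ _))) compA
    -!(compA (cross w y z)).
  by rewrite ecap_cross.
move/(congr1 (fun f => dual y ◁ f)): slide; rewrite !(whisk_comp (dual y)) =>
  slide.
rewrite (comp4 _ slide) !compA.
rewrite -2!(compA _ (dual y ◁ w ◁ _)) -cross_nat !compA.
by rewrite (comp2 _ (esym (cross_nat _ _ _))) compA ecap_cross -!whisk_comp.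
Qed.

Lemma comp_hcap_nat x y z t (f : mor z t) :
  let cap z :=
    ecap y z ∘ (dual y ◁ ecap x (y ⊗ z)) ∘ (dual y ◁ dual x ◁ assoc x y z)
      ∘ assoc (dual y) (dual x) ((x ⊗ y) ⊗ z) in
  cap t ∘ ((dual y ⊗ dual x) ◁ (x ⊗ y) ◁ f) = f ∘ cap z.
Proof.
rewrite /= (comp2 _ (whisk_whisk _ _ _)) compA.
rewrite (comp2 _ (esym (whisk_comp (dual y) (dual x ◁ _) _))).
rewrite -(whisk_comp (dual x)) whisk_whisk 2!whisk_comp compA.
rewrite (comp2 _ (esym (whisk_comp (dual y) (ecap _ _) _))) ecap_nat whisk_comp
  compA.
by rewrite ecap_nat !compA.
Qed.

Lemma comp_hcup_nat x y z t (f : mor z t) :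
  let cup z :=
    isoinv (assoc x y ((dual y ⊗ dual x) ⊗ z))
    ∘ (x ◁ y ◁ isoinv (assoc (dual y) (dual x) z))
    ∘ (x ◁ ecup y (dual x ⊗ z)) ∘ ecup x z in
  ((x ⊗ y) ◁ (dual y ⊗ dual x) ◁ f) ∘ cup z = cup t ∘ f.
Proof.
rewrite /= !compA -whisk_whiskV.
rewrite (comp2 _ (esym (whisk_comp x (y ◁ _) (y ◁ _)))) -(whisk_comp y).
rewrite -whisk_whiskV 2!whisk_comp compA.
rewrite (comp2 _ (esym (whisk_comp x _ (ecup _ _)))) ecup_nat whisk_comp compA.
by rewrite (comp2 _ (ecup_nat _ _)) compA.
Qed.

Definition comp_hdual x y : hdual (x ⊗ y) :=
  HDual (@comp_hcap_nat x y) (@comp_hcup_nat x y) (comp_hdual_cupK x y)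
    (comp_hdual_cross x y).

Definition ecapc x z := hcapc (hdual_dual x) z.

Lemma ecapcE x z :
  ecapc x z = ecap x z ∘ cross x (dual x) z ∘ (twist x ▷ (dual x ⊗ z)).
Proof. exact: hcapcE. Qed.

Lemma ecapc_nat x z t (f : mor z t) :
  ecapc x t ∘ (x ◁ dual x ◁ f) = f ∘ ecapc x z.
Proof. exact: (hcapc_nat (hdual_dual x)). Qed.

Lemma cross_braid x y z :
  assoc y x z ∘ (braid x y ▷ z) = cross x y z ∘ assoc x y z.
Proof. by rewrite crossE isoKc. Qed.

(** The untwisted right cap is the cap of [ev y] composed with a braiding, so strands slide past it
    as past any cap. *)
Lemma ecap_braid x y z :
  ecap y (x ⊗ z) ∘ cross y (dual y) (x ⊗ z) ∘ (y ◁ cross x (dual y) z)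
    ∘ cross x y (dual y ⊗ z) = x ◁ (ecap y z ∘ cross y (dual y) z).
Proof. by rewrite /ecap -!cap_braid cap_crossr. Qed.

(** The double braiding of [x] and [y] separates the two caps: Yang-Baxter brings one of its
    crossings next to the cap of [x], which then slides off [y]; the other crossing lets the cap of
    [y] slide off [x]. *)
Lemma comp_untwisted x y z :
  ecap y z ∘ (dual y ◁ (ecap x (y ⊗ z) ∘ cross x (dual x) (y ⊗ z)))
    ∘ (dual y ◁ x ◁ cross y (dual x) z) ∘ cross x (dual y) (y ⊗ (dual x ⊗ z))
    ∘ (x ◁ cross y (dual y) (dual x ⊗ z)) ∘ cross y x (dual y ⊗ (dual x ⊗ z))
    ∘ cross x y (dual y ⊗ (dual x ⊗ z)) =
  ecap x z ∘ cross x (dual x) z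
    ∘ (x ◁ (ecap y (dual x ⊗ z) ∘ cross y (dual y) (dual x ⊗ z))).
Proof.
rewrite (comp3 _ (yang_baxter y x (dual y) (dual x ⊗ z))) (whisk_comp (dual y))
  !compA.
have slide : ecap x (y ⊗ z) ∘ cross x (dual x) (y ⊗ z)
    ∘ (x ◁ cross y (dual x) z) ∘ cross y x (dual x ⊗ z) =
    y ◁ (ecap x z ∘ cross x (dual x) z) by exact: ecap_braid.
move/(congr1 (fun f => dual y ◁ f)): slide; rewrite 3!(whisk_comp (dual y)) =>
  slide.
by rewrite (comp4 _ slide) ecap_nat -ecap_braid !compA.
Qed.

Lemma tensmE x x' y y' (f : mor x x') (g : mor y y') :
  f ⊠ g = (f ▷ y') ∘ (x ◁ g).
Proof. by rewrite -tensm_comp comp1m compm1. Qed.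

(* Compatibility of the twist with tensor products makes the right caps
   multiplicative. *)
Lemma comp_hcapcE x y z :
  hcapc (comp_hdual x y) z =
  ecapc x z ∘ (x ◁ ecapc y (dual x ⊗ z))
    ∘ (x ◁ y ◁ assoc (dual y) (dual x) z)
    ∘ assoc x y ((dual y ⊗ dual x) ⊗ z).
Proof.
rewrite hcapcE /= (comp2 _ (cross_tensr (x ⊗ y) (dual y) (dual x) z)) !compA.
rewrite (comp2 _ (esym (whisk_comp (dual y) (dual x ◁ _) (cross _ _ _)))).
rewrite cross_tensl !(whisk_comp (dual y)) !compA.
rewrite (comp2 _ (cross_tensl x y (dual y) (dual x ⊗ z))) !compA.
rewrite (comp2 _ (esym (whisk_exch _ _))) !compA twist_tens !comp_whisk !compA.
rewrite (comp2 _ (cross_braid _ _ _)) !compA (comp2 _ (cross_braid _ _ _))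
  !compA.
rewrite (comp2 _ (assoc_nat _ _ _)) !compA (tensmE (twist x)) !compA.
have := comp_untwisted x y z; rewrite (whisk_comp (dual y)) !compA => ->.
rewrite (comp2 _ (esym (whisk_exch _ _))) !compA.
rewrite -(compA _ (x ◁ _) (x ◁ _)) -whisk_comp -!ecapcE.
by rewrite (comp2 _ (whisk_whisk _ _ _)) !compA.
Qed.

(** * Monodromy and loops around a strand *)

Definition dcross j x z : mor (j ⊗ (x ⊗ z)) (j ⊗ (x ⊗ z)) :=
  locked (cross x j z ∘ cross j x z).

Lemma dcrossE j x z : dcross j x z = cross x j z ∘ cross j x z.
Proof. by rewrite /dcross -lock. Qed.

Lemma dcross_nat j x z t (f : mor z t) :
  dcross j x t ∘ (j ◁ x ◁ f) = (j ◁ x ◁ f) ∘ dcross j x z.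
Proof.
by rewrite !dcrossE (comp2 _ (cross_nat _ _ _)) !compA cross_nat.
Qed.

Lemma dcross_tens j x y z :
  (j ◁ assoc x y z) ∘ dcross j (x ⊗ y) z =
  cross x j (y ⊗ z) ∘ (x ◁ dcross j y z) ∘ cross j x (y ⊗ z)
    ∘ (j ◁ assoc x y z).
Proof.
rewrite !dcrossE compA cross_tensl (comp2 _ (cross_tensr _ _ _ _)) !compA.
by rewrite whisk_comp !compA.
Qed.

(** The partial trace over [x] of the double braiding: a strand [j] with a loop coloured by [x]
    around it. *)
Definition encircle j x z : mor (j ⊗ z) (j ⊗ z) :=
  locked ((j ◁ ecapc x z) ∘ dcross j x (dual x ⊗ z) ∘ (j ◁ ecup x z)).

Lemma encircleE j x z :
  encircle j x z =
  (j ◁ ecapc x z) ∘ dcross j x (dual x ⊗ z) ∘ (j ◁ ecup x z).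
Proof. by rewrite /encircle -lock. Qed.

(** The mate of the identity compares the two duals of [x]; it moves from the cup, through the
    double braiding, into the cap. Loops coloured by a tensor product can thus be closed with
    [comp_hdual]. *)
Lemma encircle_hdual j x (D : hdual x) z :
  encircle j x z =
  (j ◁ hcapc D z) ∘ dcross j x (hobj D ⊗ z) ∘ (j ◁ hcup D z).
Proof.
rewrite encircleE; pose f := transp D (idm x) z.
have cupE : ecup x z = (x ◁ f) ∘ hcup D z.
  by rewrite -transp_cup tensm_id comp1m.
have capcE : ecapc x z ∘ (x ◁ f) = hcapc D z.
  by rewrite /ecapc transp_capc tensm_id compm1.
rewrite cupE whisk_comp compA (comp2 _ (dcross_nat _ _ _)) compA.
by rewrite -whisk_comp capcE.
Qed.

Lemma encircle_nat j x z t (f : mor z t) :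
  encircle j x t ∘ (j ◁ f) = (j ◁ f) ∘ encircle j x z.
Proof.
rewrite !encircleE -compA -whisk_comp -ecup_nat whisk_comp compA.
by rewrite (comp2 _ (dcross_nat _ _ _)) !compA -!whisk_comp ecapc_nat.
Qed.

(** With nested caps and cups, a loop coloured by [x ⊗ y] becomes a loop coloured by [y] inside one
    coloured by [x]. *)
Lemma encircle_tens j x y z :
  encircle j (x ⊗ y) z =
  (j ◁ ecapc x z) ∘ cross x j (dual x ⊗ z) ∘ (x ◁ encircle j y (dual x ⊗ z))
    ∘ cross j x (dual x ⊗ z) ∘ (j ◁ ecup x z).
Proof.
rewrite (encircle_hdual j (comp_hdual x y)) comp_hcapcE /= !(whisk_comp j)
  !compA.
rewrite (comp2 _ (dcross_tens _ _ _ _)) !compA.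
rewrite (comp2 _ (esym (whisk_comp j (isom (assoc x y _)) _))) isoinvK tensm_id
  compm1.
rewrite !(comp2 _ (esym (cross_nat x j (y ◁ _)))) !compA.
rewrite (comp2 _ (esym (cross_nat x j (ecapc _ _)))) !compA.
rewrite (comp2 _ (cross_nat j x (_ ◁ _))) !compA.
rewrite (comp2 _ (cross_nat j x (ecup _ _))) !compA.
rewrite encircleE !(whisk_comp x) !compA.
rewrite (comp2 _ (esym (whisk_comp x _ (dcross _ _ _)))) -dcross_nat whisk_comp
  compA.
rewrite (comp2 _ (esym (whisk_comp x (j ◁ y ◁ isom _) _))).
by rewrite -!(whisk_comp j) -(whisk_comp y) isoinvK !tensm_id compm1.
Qed.

Lemma dcross_assoc j x z u :
  dcross j x (z ⊗ u) ∘ ((j ◁ assoc x z u) ∘ assoc j (x ⊗ z) u) =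
  (j ◁ assoc x z u) ∘ assoc j (x ⊗ z) u ∘ (dcross j x z ▷ u).
Proof.
rewrite !dcrossE -(compA (cross x j _)) (cross_tens j x z u) compA
  (cross_tens x j z u).
by rewrite comp_whisk !compA.
Qed.

Lemma ecapc_cap x z :
  ecapc x z = cap (ev x ∘ braid x (dual x) ∘ (twist x ▷ dual x)) z.
Proof. by rewrite cap_whiskl cap_braid ecapcE. Qed.

(** Cups, caps and double braidings all leave the tail alone, hence so does the loop; it is
    therefore determined by its value on the tail [one]. *)
Lemma encircle_assoc j x z u :
  encircle j x (z ⊗ u) ∘ assoc j z u = assoc j z u ∘ (encircle j x z ▷ u).
Proof.
rewrite !encircleE !comp_whisk !compA.
rewrite assoc_nat (ecapc_cap x z) -cap_tens -ecapc_cap !(whisk_comp j) /=.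
rewrite (comp3 _ (esym (dcross_assoc j x (dual x ⊗ z) u))) !compA.
rewrite (comp2 _ (esym (dcross_nat _ _ _))) compA (comp2 _ (assoc_nat _ _ _))
  compA.
by rewrite /ecup -(cup_tens (coev x) z u) !(whisk_comp j) !compA.
Qed.

(** The nested duals split the trace over [j ⊗ x] into a trace over [x], which produces the loop,
    followed by a trace over [j]. *)
Lemma qtrace_encircle j x z :
  hcapc (comp_hdual j x) z ∘ ((braid x j ∘ braid j x) ▷ _)
    ∘ hcup (comp_hdual j x) z =
  ecapc j z ∘ encircle j x (dual j ⊗ z) ∘ ecup j z.
Proof.
rewrite comp_hcapcE /= comp_whisk !compA.
rewrite (comp2 _ (cross_braid _ _ _)) !compA (comp2 _ (cross_braid _ _ _))
  !compA.
rewrite isoinvKc (comp2 _ (esym (dcrossE _ _ _)))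
  (comp2 _ (esym (dcross_nat _ _ _))).
rewrite encircleE !compA (comp2 _ (esym (whisk_comp j (x ◁ isom _) _))).
by rewrite -(whisk_comp x) isoinvK !tensm_id compm1.
Qed.

(** * The object [x] as a left dual of its dual *)

Definition ecapV x z : mor (x ⊗ (dual x ⊗ z)) z :=
  locked (ecap x z ∘ cross x (dual x) z).

Definition ecupV x z : mor z (dual x ⊗ (x ⊗ z)) :=
  locked (crossV (dual x) x z ∘ ecup x z).

Lemma ecapVE x z : ecapV x z = ecap x z ∘ cross x (dual x) z.
Proof. by rewrite /ecapV -lock. Qed.

Lemma ecupVE x z : ecupV x z = crossV (dual x) x z ∘ ecup x z.
Proof. by rewrite /ecupV -lock. Qed.

Lemma ecapV_nat x z t (f : mor z t) :
  ecapV x t ∘ (x ◁ dual x ◁ f) = f ∘ ecapV x z.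
Proof. by rewrite !ecapVE (comp2 _ (cross_nat _ _ _)) !compA ecap_nat. Qed.

Lemma ecupV_nat x z t (f : mor z t) :
  (dual x ◁ x ◁ f) ∘ ecupV x z = ecupV x t ∘ f.
Proof.
by rewrite !ecupVE !compA -crossV_nat (comp2 _ (ecup_nat _ _)) compA.
Qed.

Lemma ecapV_cross x w z :
  ecapV x (w ⊗ z) ∘ (x ◁ cross w (dual x) z) ∘ cross w x (dual x ⊗ z) =
  w ◁ ecapV x z.
Proof. by rewrite !ecapVE /ecap -!cap_braid cap_crossr. Qed.

(** Sliding the cup past [dual x] and applying Yang-Baxter cancels the crossings in [ecapV] against
    the inverse crossings in [ecupV], down to the zigzag [ecapK]. *)
Lemma ecupVK x z : (dual x ◁ ecapV x z) ∘ ecupV x (dual x ⊗ z) = idm _.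
Proof.
rewrite ecapVE ecupVE /ecup cup_crossV !whisk_comp !compA.
rewrite (comp3 _ (yang_baxterV (dual x) x (dual x) z)) !compA whisk_crossVKc.
by rewrite /ecap cap_crossV whisk_crossVKc ecapK.
Qed.

Lemma ecapVK x z : ecapV x (x ⊗ z) ∘ (x ◁ ecupV x z) = idm _.
Proof.
rewrite ecapVE ecupVE /ecap -cap_crossl !whisk_comp !compA.
rewrite (comp3 _ (yang_baxter x (dual x) x z)) !compA whisk_crossVKc.
by rewrite (comp3 _ (cup_crossr _ _ _)) ecupK.
Qed.

Definition dual_hdual x : hdual (dual x) :=
  HDual (@ecapV_nat x) (@ecupV_nat x) (ecupVK x) (ecapV_cross x).

(** The twist of [dual x] passes the crossing, which cancels its inverse in [ecupV]; on the cup,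
    [twist_dual] then trades it for the twist of [x]. *)
Lemma dual_hdual_loop x z :
  hcapc (dual_hdual x) z ∘ hcup (dual_hdual x) z = ecapc x z ∘ ecup x z.
Proof.
rewrite hcapcE /= ecapVE ecupVE !compA.
rewrite (comp2 _ (cross_natl _ _ _)) !compA crossVKc.
rewrite (comp2 _ (esym (cup_whiskr _ _ _))) -twist_dual cup_whiskl.
by rewrite ecapcE compA.
Qed.

End FamilyDuals.

(** * Quantum traces *)

Section Traces.
Variables (K : fieldType) (C : ribbonCategory K).
Hypothesis one_scalar :
  forall s : mor (one : C) one, s = scalar_of s *: idm one.
Hypothesis one_neq0 : idm (one : C) != 0.
Implicit Types x y z j : C.

(** Identities between traces are proved below as equalities of endomorphisms of the unit and
    descend to scalars by this cancellation. *)
Lemma scale_idm_inj a b : a *: idm (one : C) = b *: idm one -> a = b.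
Proof.
move/eqP; rewrite -subr_eq0 -scalerBl scaler_eq0 (negPf one_neq0) orbF subr_eq0.
by move/eqP.
Qed.

Lemma qtraceE x z (f : mor x x) :
  ecapc x z ∘ (f ▷ (dual x ⊗ z)) ∘ ecup x z = qtrace f *: idm z.
Proof.
rewrite /ecapc capc_scalar [X in X ▷ z]one_scalar Zwhisk tensm_id compmZ compZm.
by rewrite compm1 isoinvK.
Qed.

Lemma qdimE x z : ecapc x z ∘ ecup x z = qdim x *: idm z.
Proof. by rewrite -qtraceE tensm_id compm1. Qed.

Lemma qtrace_hdual x (D : hdual x) z (f : mor x x) :
  hcapc D z ∘ (f ▷ (hobj D ⊗ z)) ∘ hcup D z = qtrace f *: idm z.
Proof.
rewrite -qtraceE -{2}(compm1 f) comp_whisk compA (comp2 _ (transp_cup D _ _)).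
rewrite compA (comp2 _ (whisk_exch _ _)) compA.
by rewrite /ecapc transp_capc tensm_id compm1.
Qed.

(** The morphism [f] travels around the loop: it enters the dual strand at the cup and leaves it at
    the cap. *)
Lemma qtraceC x y (f : mor x y) (g : mor y x) : qtrace (g ∘ f) = qtrace (f ∘ g).
Proof.
apply: scale_idm_inj; rewrite -!qtraceE !comp_whisk !compA.
rewrite (comp2 _ (transp_cup (hdual_dual y) _ _)) compA
  (comp2 _ (whisk_exch _ _)).
by rewrite compA /ecapc transp_capc.
Qed.

Lemma qtrace_sum x (I : finType) (E : I -> mor x x) :
  qtrace (\sum_i E i) = \sum_i qtrace (E i).
Proof.
apply: scale_idm_inj; rewrite -!qtraceE sum_whisk comp_sumr comp_suml
  scaler_suml.
by apply: eq_bigr => i _; rewrite qtraceE.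
Qed.

Lemma hopfC x y : hopf x y = hopf y x.
Proof. exact: qtraceC. Qed.

(** Naturality moves [f] through the double braiding, and cyclicity brings it back on the other
    side. *)
Lemma qtrace_double_braid x x' y (f : mor x x') (g : mor x' x) :
  qtrace (braid y x ∘ braid x y ∘ ((g ∘ f) ▷ y)) =
  qtrace (braid y x' ∘ braid x' y ∘ ((f ∘ g) ▷ y)).
Proof.
rewrite !comp_whisk !compA (comp2 _ (braid_nat _ _)) !compA braid_nat.
rewrite -(compA _ _ (f ▷ y)) -(compA _ _ (f ▷ y)) qtraceC !compA.
by rewrite [LHS]qtraceC !compA.
Qed.

Lemma hopf_iso x x' y : isomorphic x x' -> hopf x y = hopf x' y.
Proof.
case=> i; rewrite /hopf.
rewrite -(compm1 (braid y x ∘ _)) -(compm1 (braid y x' ∘ _)) -!tensm_id.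
by rewrite -{1}(isoK i) qtrace_double_braid isoinvK.
Qed.

Lemma hopf_direct_sum n (s : 'I_n -> C) x y :
  is_direct_sum s x -> hopf x y = \sum_k hopf (s k) y.
Proof.
case=> inj [proj [projK _ sumE]]; rewrite /hopf.
rewrite -(compm1 (braid y x ∘ _)) -tensm_id -sumE sum_whisk comp_sumr
  qtrace_sum.
apply: eq_bigr => k _.
by rewrite qtrace_double_braid projK tensm_id compm1.
Qed.

Lemma hopf_one x : hopf x one = qdim x.
Proof.
have br : isom (braid x one) = isoinv (lunit x) ∘ runit x.
  by apply: (iso_mono (i := lunit x)); rewrite braid_lunit compA isoinvK comp1m.
have br' : isom (braid one x) = isoinv (runit x) ∘ lunit x.
  by apply: (iso_mono (i := runit x)); rewrite braid_runit compA isoinvK comp1m.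
by rewrite /hopf br br' !compA isoinvKc qtraceC isoinvK.
Qed.

Lemma qdim_tens x y : qdim (x ⊗ y) = qdim x * qdim y.
Proof.
apply: scale_idm_inj; rewrite -(qtrace_hdual (comp_hdual x y)) comp_hcapcE /=.
rewrite tensm_id compm1 !compA isoinvKc.
rewrite (comp2 _ (esym (whisk_comp x (y ◁ isom _) _))).
rewrite -(whisk_comp y) isoinvK !tensm_id compm1.
rewrite (comp2 _ (esym (whisk_comp x _ _))) qdimE.
by rewrite whiskZ tensm_id compmZ compZm compm1 qdimE scalerA mulrC.
Qed.

Lemma qdim_dual x : qdim (dual x) = qdim x.
Proof.
apply: scale_idm_inj; rewrite -(qtrace_hdual (dual_hdual x)) -qdimE.
by rewrite tensm_id compm1 dual_hdual_loop.
Qed.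

(** On the tail [one] the loop is an endomorphism of [j] up to [runit]; [encircle_assoc] extends the
    scalar to [one ⊗ z], and naturality along [lunit z] to [z]. *)
Lemma encircle_scalar j x :
  (forall f : mor j j, exists a, f = a *: idm j) ->
  exists a, forall z, encircle j x z = a *: idm (j ⊗ z).
Proof.
move=> /(_ (runit j ∘ encircle j x one ∘ isoinv (runit j)))[a fE].
exists a => z.
have e1 : encircle j x one = a *: idm _.
  apply: (iso_mono (i := runit j)); apply: (isoinv_epi (i := runit j)).
  by rewrite fE compmZ compm1 compZm isoinvK.
have e2 : encircle j x (one ⊗ z) = a *: idm _.
  apply: (iso_epi (i := assoc j one z)).
  by rewrite encircle_assoc e1 Zwhisk tensm_id compmZ compm1 compZm comp1m.
apply: (iso_epi (i := whisk_iso j (lunit z))).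
by rewrite /= encircle_nat e2 compmZ compm1 compZm comp1m.
Qed.

(* For simple j, x |-> hopf x j / qdim j is a character of the fusion ring:
   encircling j by x ⊗ y is encircling it by y and then by x. *)
Lemma hopf_tens j x y :
  (forall f : mor j j, exists a, f = a *: idm j) ->
  hopf (x ⊗ y) j * qdim j = hopf x j * hopf y j.
Proof.
move=> j_end; have [a aE] := encircle_scalar x j_end.
have [b bE] := encircle_scalar y j_end.
(* Closing up the strand [j] turns the loop into the Hopf link. *)
have hopfE u c : (forall z, encircle j u z = c *: idm (j ⊗ z)) ->
    hopf u j = c * qdim j.
  move=> cE; apply: scale_idm_inj; rewrite hopfC /hopf.
  rewrite -(qtrace_hdual (comp_hdual j u)) qtrace_encircle cE.
  by rewrite compmZ compm1 compZm -scalerA -qdimE.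
(* The inner loop becomes the scalar [b], which leaves the single loop [x]. *)
have abE z : encircle j (x ⊗ y) z = (a * b) *: idm (j ⊗ z).
  rewrite encircle_tens bE whiskZ tensm_id compmZ compm1 !compZm.
  rewrite -(compA (j ◁ _) (cross _ _ _)) -dcrossE -encircleE aE scalerA.
  by rewrite mulrC.
by rewrite (hopfE _ _ aE) (hopfE _ _ bE) (hopfE _ _ abE) mulrACA mulrA.
Qed.

End Traces.

(** * Schur's lemma and dimensions *)

Section Dimensions.
Variable K : fieldType.
Implicit Types U V W : vectType K.

Import VectorInternalTheory.

Lemma dim_le_inj U V (f : U -> V) :
  linear f -> injective f -> (dim U <= dim V)%N.
Proof.
move=> f_lin f_inj.
pose fL := GRing.isLinear.Build K U V *:%R f f_lin.
pose F : {linear U -> V} := HB.pack f fL.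
have ker0 : lker (linfun F) == 0%VS.
  by apply/lker0P => u v; rewrite !lfunE; apply: f_inj.
rewrite -!dimvf -(limg_dim_eq (f := linfun F) (U := fullv)) ?dimvS ?subvf //.
by rewrite (eqP ker0) capv0.
Qed.

Lemma dim_eq_bij U V (f : U -> V) (g : V -> U) :
  linear f -> linear g -> cancel f g -> cancel g f -> dim U = dim V.
Proof.
move=> f_lin g_lin fK gK; apply/eqP; rewrite eqn_leq.
rewrite (dim_le_inj f_lin (can_inj fK)).
by rewrite (dim_le_inj g_lin (can_inj gK)).
Qed.

Lemma dim_dsum (I : finType) (V : I -> vectType K) :
  dim (dsum V) = \sum_i dim (V i).
Proof.
(* The dimension of [dsum] is this cardinal by construction. *)
transitivity #|{: {i : I & 'I_(dim (V i))}}|; first by [].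
rewrite card_tagged sumnE big_map big_enum; apply: eq_bigr => i _.
by rewrite card_ord.
Qed.

End Dimensions.

Section Eigenvectors.
Import VectorInternalTheory.

Lemma endo_eigenvector (K : numClosedFieldType) (V : vectType K) (f : V -> V) :
  linear f -> (0 < dim V)%N -> exists a v, v != 0 /\ f v = a *: v.
Proof.
move=> f_lin V_gt0.
pose fL := GRing.isLinear.Build K V V *:%R f f_lin.
pose F : {linear V -> V} := HB.pack f fL.
have [a /eigenvalueP[r rE r_neq0]] :=
  eigenvalue_closed (lin1_mx (v2r \o F \o r2v)) V_gt0.
exists a, (r2v r); split.
  by apply: contraNneq r_neq0 => r0; rewrite -[r]r2vK r0 linear0.
by move: rE; rewrite mul_rV_lin1 /= => /(congr1 r2v); rewrite v2rK linearZ.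
Qed.

End Eigenvectors.

(** * Simple objects and spaces of morphisms *)

Section Simples.
Variables (K : numClosedFieldType) (C : linCategory K).
Hypothesis C_ab : abelian C.
Implicit Types x y z : C.

Lemma simple_idm_neq0 x : simple x -> idm x != 0.
Proof.
case=> nz _; apply/eqP => id0; apply: nz => y; split=> f.
  by rewrite -(compm1 f) id0 compm0.
by rewrite -(comp1m f) id0 comp0m.
Qed.

(** The kernel of [f] is a subobject of [x]: were it all of [x], [f] would vanish, so it is zero and
    [f] is mono. Simplicity of [y] then makes [f] invertible. *)
Lemma schur_iso x y (f : mor x y) : simple x -> simple y -> f != 0 -> is_iso f.
Proof.
move=> [x_nz x_simple] [_ y_simple] f_neq0.
have [z [k [fk0 k_univ]]] := has_kernels C_ab f.
have k_mono : mono k.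
  move=> w g h gh; have [|u [_ u_uniq]] := k_univ w (k ∘ g).
    by rewrite compA fk0 comp0m.
  by rewrite -(u_uniq g erefl) -(u_uniq h (esym gh)).
case: (x_simple _ _ k_mono) => [z0 | [k' [_ kk']]]; last first.
  by case/eqP: f_neq0; rewrite -(compm1 f) -kk' compA fk0 comp0m.
have f_mono : mono f.
  move=> w g h fgh; have [|u [uE _]] := k_univ w (g - h).
    by rewrite compmB fgh subrr.
  by apply/eqP; rewrite -subr_eq0 -uE (proj2 (z0 w) u) compm0.
by case: (y_simple _ _ f_mono).
Qed.

(** Composition with [f] has an eigenvector [v] in the endomorphisms of [x]; by Schur [v] is
    invertible and can be cancelled from the eigenvalue equation. *)
Lemma simple_end x (f : mor x x) : simple x -> exists a, f = a *: idm x.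
Proof.
move=> x_simple.
have [|a [v [v_neq0 fv]]] := endo_eigenvector (@comp_linr _ _ x _ _ f).
  rewrite -dimvf lt0n dimv_eq0; apply/eqP => full0.
  have := memvf (idm x); rewrite full0 memv0.
  by rewrite (negPf (simple_idm_neq0 x_simple)).
exists a; have [v' [_ vv']] := schur_iso x_simple x_simple v_neq0.
by rewrite -(compm1 f) -vv' compA fv compZm.
Qed.

Lemma dim_end_simple x : simple x -> dim (mor x x) = 1.
Proof.
move=> x_simple; rewrite -dimvf.
suff -> : fullv = <[idm x]>%VS by rewrite dim_vline simple_idm_neq0.
apply/eqP; rewrite eqEsubv subvf andbT; apply/subvP => f _.
by have [a ->] := simple_end f x_simple; rewrite memvZ ?memv_line.
Qed.

Lemma dim_mor_simple0 x y :
  simple x -> simple y -> ~ isomorphic x y -> dim (mor x y) = 0.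
Proof.
move=> x_simple y_simple xy; rewrite -dimvf; apply/eqP; rewrite dimv_eq0.
apply/eqP/vspaceP => f; rewrite memvf memv0; have [//|f_neq0] := eqVneq f 0.
have [g [gf fg]] := schur_iso x_simple y_simple f_neq0.
by case: xy; split; exact: Iso gf fg.
Qed.

Lemma dim_mor_isol x x' y : isomorphic x x' -> dim (mor x y) = dim (mor x' y).
Proof.
case=> i; apply:
  (dim_eq_bij (f := fun f => f ∘ isoinv i) (g := fun f => f ∘ i)).
- exact: comp_linl.
- exact: comp_linl.
- by move=> f; rewrite isoKc.
- by move=> f; rewrite isoinvKc.
Qed.

Lemma dim_mor_isor x y y' : isomorphic y y' -> dim (mor x y) = dim (mor x y').
Proof.
case=> i; apply:
  (dim_eq_bij (f := fun f => i ∘ f) (g := fun f => isoinv i ∘ f)).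
- exact: comp_linr.
- exact: comp_linr.
- by move=> f; rewrite compA isoK comp1m.
- by move=> f; rewrite compA isoinvK comp1m.
Qed.

Lemma dim_mor_suml n (s : 'I_n -> C) x y :
  is_direct_sum s x -> dim (mor x y) = \sum_k dim (mor (s k) y).
Proof.
case=> inj [proj [projK projC sumE]]; rewrite -dim_dsum.
apply: (dim_eq_bij
  (f := fun f => [ffun k => f ∘ inj k] : dsum (fun k => mor (s k) y))
  (g := fun F : dsum (fun k => mor (s k) y) => \sum_k F k ∘ proj k)).
- by move=> a f g; apply/ffunP => k; rewrite !ffunE comp_linl.
- move=> a F G; rewrite scaler_sumr -big_split; apply: eq_bigr => k _ /=.
  by rewrite !ffunE comp_linl.
- move=> f; under eq_bigr do rewrite ffunE -compA.
  by rewrite -comp_sumr sumE compm1.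
- move=> F; apply/ffunP => k; rewrite ffunE comp_suml (bigD1 k) //= -compA
  projK.
  rewrite compm1 big1 ?addr0 // => l kl.
  by rewrite -compA projC 1?eq_sym // compm0.
Qed.

Lemma dim_mor_sumr n (s : 'I_n -> C) x y :
  is_direct_sum s x -> dim (mor y x) = \sum_k dim (mor y (s k)).
Proof.
case=> inj [proj [projK projC sumE]]; rewrite -dim_dsum.
apply: (dim_eq_bij
  (f := fun f => [ffun k => proj k ∘ f] : dsum (fun k => mor y (s k)))
  (g := fun F : dsum (fun k => mor y (s k)) => \sum_k inj k ∘ F k)).
- by move=> a f g; apply/ffunP => k; rewrite !ffunE comp_linr.
- move=> a F G; rewrite scaler_sumr -big_split; apply: eq_bigr => k _ /=.
  by rewrite !ffunE comp_linr.
- move=> f; under eq_bigr do rewrite ffunE compA.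
  by rewrite -comp_suml sumE comp1m.
- move=> F; apply/ffunP => k; rewrite ffunE comp_sumr (bigD1 k) //= compA projK.
  rewrite comp1m big1 ?addr0 // => l kl.
  by rewrite compA projC // comp0m.
Qed.

End Simples.

(** Here [dual x] stands on the side opposite to the adjunction given by [ev] and [coev], hence the
    families [ecapV] and [ecupV]. *)
Lemma dim_mor_dual (K : numClosedFieldType) (C : ribbonCategory K) (x u v : C) :
  dim (mor (x ⊗ u) v) = dim (mor u (dual x ⊗ v)).
Proof.
apply: (dim_eq_bij
  (f := fun h : mor (x ⊗ u) v => (dual x ◁ h) ∘ ecupV x u)
  (g := fun g : mor u (dual x ⊗ v) => ecapV x v ∘ (x ◁ g))).
- by move=> a f g; rewrite tensm_linr comp_linl.
- by move=> a f g; rewrite tensm_linr comp_linr.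
- by move=> h; rewrite whisk_comp compA ecapV_nat -compA ecapVK compm1.
- by move=> g; rewrite whisk_comp -compA ecupV_nat compA ecupVK comp1m.
Qed.

(** * The fusion rules *)

Section Modular.
Variables (K : numClosedFieldType) (C : modularCategory K).
Implicit Types (i j m : irr C) (x y : C).

Let C_ab := mod_abelian C.

Lemma end_one (s : mor (one : C) one) : exists a, s = a *: idm one.
Proof.
case: (rep_irr0 C) => i.
have [a aE] := simple_end C_ab (isoinv i ∘ s ∘ i) (@rep_simple K C (irr0 C)).
exists a; apply: (iso_epi (i := i)); apply: (iso_mono (i := iso_sym i)).
by rewrite /= compA aE compZm comp1m compmZ isoK.
Qed.

Lemma idm_one_neq0 : idm (one : C) != 0.
Proof.
case: (rep_irr0 C) => i; apply: contraNneq
  (simple_idm_neq0 (@rep_simple K C (irr0 C))).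
by move=> id0; rewrite -(isoK i) -(comp1m (isom i)) id0 comp0m compm0.
Qed.

Lemma scalar_ofE (s : mor (one : C) one) : s = scalar_of s *: idm one.
Proof.
have [a ->] := end_one s; congr (_ *: _); rewrite /scalar_of linearZ /=.
rewrite (coord_free ord0 ord0) ?mulr1 // seq1_free.
exact: idm_one_neq0.
Qed.

Let s i j := hopf (rep i) (rep j).
Let d i := qdim (rep i).

Lemma rep_end j (f : mor (rep j) (rep j)) : exists a, f = a *: idm (rep j).
Proof. exact: (simple_end C_ab f (@rep_simple K C j)). Qed.

Lemma dim_mor_rep i j : dim (mor (rep i) (rep j)) = (i == j).
Proof.
have [->|ij] := eqVneq i j; first exact:
  (dim_end_simple C_ab (@rep_simple K C j)).
apply: (dim_mor_simple0 C_ab (@rep_simple K C i) (@rep_simple K C j)) => e.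
by move: ij; rewrite (rep_inj e) eqxx.
Qed.

(** The form in which semisimplicity is used: dimensions of morphism spaces and Hopf invariants are
    additive and invariant under isomorphism. *)
Lemma simple_decomposition x : exists n (t : 'I_n -> irr C),
  [/\ forall y, dim (mor x y) = \sum_k dim (mor (rep (t k)) y),
      forall y, dim (mor y x) = \sum_k dim (mor y (rep (t k)))
    & forall y, hopf x y = \sum_k hopf (rep (t k)) y].
Proof.
have [n [u [u_simple ux]]] := mod_semisimple x.
have [t tE] := fin_all_exists (fun k => rep_surj (u_simple k)).
exists n, t; split=> y.
- rewrite (dim_mor_suml _ ux); apply: eq_bigr => k _; exact: dim_mor_isol.
- rewrite (dim_mor_sumr _ ux); apply: eq_bigr => k _; exact: dim_mor_isor.
- rewrite (hopf_direct_sum scalar_ofE idm_one_neq0 _ ux).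
  by apply: eq_bigr => k _; apply: (hopf_iso scalar_ofE idm_one_neq0).
Qed.

Lemma hopf_suml x y :
  hopf x y = \sum_m (dim (mor x (rep m)))%:R * hopf (rep m) y.
Proof.
have [n [t [dimE _ ->]]] := simple_decomposition x.
under [RHS]eq_bigr do rewrite dimE natr_sum mulr_suml.
rewrite exchange_big; apply: eq_bigr => k _ /=.
rewrite (bigD1 (t k)) //= dim_mor_rep eqxx mul1r big1 ?addr0 // => m tk.
by rewrite dim_mor_rep eq_sym (negPf tk) mul0r.
Qed.

Lemma hopf_sumr x y :
  hopf x y = \sum_m (dim (mor (rep m) x))%:R * hopf (rep m) y.
Proof.
have [n [t [_ dimE ->]]] := simple_decomposition x.
under [RHS]eq_bigr do rewrite dimE natr_sum mulr_suml.
rewrite exchange_big; apply: eq_bigr => k _ /=.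
rewrite (bigD1 (t k)) //= dim_mor_rep eqxx mul1r big1 ?addr0 // => m tk.
by rewrite dim_mor_rep (negPf tk) mul0r.
Qed.

Lemma qdim_sumr x : qdim x = \sum_m (dim (mor (rep m) x))%:R * d m.
Proof.
rewrite -(hopf_one scalar_ofE idm_one_neq0) hopf_sumr; apply: eq_bigr => m _.
by rewrite (hopf_one scalar_ofE idm_one_neq0).
Qed.

Let H := \matrix_(i < #|irr C|, j < #|irr C|) s (enum_val i) (enum_val j).

Lemma sum_irr (F : irr C -> K) :
  \sum_i F i = \sum_(a < #|irr C|) F (enum_val a).
Proof. by rewrite (reindex _ (onW_bij _ (@enum_val_bij _))). Qed.

Lemma sum_delta (F : irr C -> K) j : \sum_m F m * (m == j)%:R = F j.
Proof.
rewrite (bigD1 j) //= eqxx mulr1 big1 ?addr0 // => m /negPf->.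
by rewrite mulr0.
Qed.

Lemma hopf_col_free (w : irr C -> K) :
  (forall i, \sum_j s i j * w j = 0) -> forall j, w j = 0.
Proof.
move=> sw0 j; pose W := \col_(b < #|irr C|) w (enum_val b).
have HW0 : H *m W = 0.
  apply/colP => a; rewrite !mxE -[RHS](sw0 (enum_val a)) sum_irr.
  by apply: eq_bigr => b _; rewrite !mxE.
have : W = 0 by rewrite -(mulKmx (hopf_nondegenerate C) W) HW0 mulmx0.
by move=> /colP/(_ (enum_rank j)); rewrite !mxE enum_rankK.
Qed.

Lemma hopfC_rep i j : s i j = s j i.
Proof. exact: (hopfC scalar_ofE idm_one_neq0). Qed.

Lemma hopf_irr0 j : s (irr0 C) j = d j.
Proof.
rewrite /s /d -(hopf_one scalar_ofE idm_one_neq0)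
  (hopfC scalar_ofE idm_one_neq0 _ one).
exact: (hopf_iso scalar_ofE idm_one_neq0 _ (rep_irr0 C)).
Qed.

Lemma hopf_tens_rep j x y :
  hopf (x ⊗ y) (rep j) * d j = hopf x (rep j) * hopf y (rep j).
Proof. exact: (hopf_tens scalar_ofE idm_one_neq0 _ _ (@rep_end j)). Qed.

(** If [d j] vanished, multiplicativity would give [s i j ^+ 2 = 0] for all [i], a zero column of an
    invertible matrix. *)
Lemma qdim_rep_neq0 j : d j != 0.
Proof.
apply/eqP => dj0; have sj0 i : s i j = 0.
  have := hopf_tens_rep j (rep i) (rep i); rewrite dj0 mulr0 => /esym/eqP.
  by rewrite mulf_eq0 orbb => /eqP.
have w0 i : \sum_m s i m * (m == j)%:R = 0.
  by rewrite sum_delta.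
by have /eqP := hopf_col_free w0 j; rewrite eqxx oner_eq0.
Qed.

Lemma globaldim_neq0 : globaldim C != 0.
Proof.
pose v j := \sum_i d i * s i j.
(* Fuse [k] with [i], expand into simples [m], and sum over [i] first: by duality this sum is the
   quantum dimension of [dual (rep k) ⊗ rep m], that is [d k * d m]. *)
have vE k j : s k j * v j = d j * d k * v j.
  transitivity (\sum_i d i * (hopf (rep k ⊗ rep i) (rep j) * d j)).
    rewrite mulr_sumr; apply: eq_bigr => i _.
    by rewrite hopf_tens_rep mulrCA.
  transitivity (\sum_i \sum_m
      (dim (mor (rep i) (dual (rep k) ⊗ rep m)))%:R * d i * (s m j * d j)).
    apply: eq_bigr => i _; rewrite hopf_suml mulr_suml mulr_sumr.
    apply: eq_bigr => m _; rewrite dim_mor_dual.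
    by rewrite -[X in d i * X]mulrA mulrCA mulrA.
  rewrite exchange_big mulr_sumr; apply: eq_bigr => m _ /=.
  rewrite -mulr_suml -qdim_sumr (qdim_tens scalar_ofE idm_one_neq0).
  rewrite (qdim_dual scalar_ofE idm_one_neq0) -/(d k) -/(d m).
  by rewrite [s m j * _]mulrC mulrACA mulrA [d k * d j]mulrC !mulrA.
have v0 j : j != irr0 C -> v j = 0.
  move=> j0; apply/eqP; apply: contraTT isT => vj_neq0.
  (* If [v j] were nonzero, column [j] would be [d j] times column [irr0 C]. *)
  have sE k : s k j = d j * d k by apply: (mulIf vj_neq0); rewrite vE.
  have w0 i : \sum_m s i m * ((m == j)%:R - d j * (m == irr0 C)%:R) = 0.
    under eq_bigr do rewrite mulrBr (mulrCA (s i _)).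
    by rewrite sumrB -mulr_sumr !sum_delta sE (hopfC_rep i) hopf_irr0 subrr.
  have /eqP := hopf_col_free w0 j.
  by rewrite eqxx (negPf j0) mulr0 subr0 oner_eq0.
(* The entry of [v] at [irr0 C] is the global dimension. If it vanishes too, the Hopf matrix kills
   the vector [d], whose entries are nonzero. *)
apply/eqP => gd0; have w0 j : \sum_i s j i * d i = 0.
  have -> : \sum_i s j i * d i = v j.
    by rewrite /v; apply: eq_bigr => i _; rewrite mulrC (hopfC_rep j).
  have [->|/v0//] := eqVneq j (irr0 C).
  by rewrite /v -[RHS]gd0; apply: eq_bigr => i _; rewrite hopfC_rep hopf_irr0
    expr2.
by have /eqP := hopf_col_free w0 (irr0 C); rewrite (negPf (qdim_rep_neq0 _)).
Qed.

Definition fusion_char j x : K := hopf x (rep j) / qdim (rep j).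

Lemma fusion_char_tens j x y :
  fusion_char j (x ⊗ y) = fusion_char j x * fusion_char j y.
Proof.
rewrite /fusion_char mulrACA -hopf_tens_rep mulrA mulfK ?qdim_rep_neq0 //.
Qed.

Lemma fusion_char_one j : fusion_char j one = 1.
Proof.
rewrite /fusion_char (hopfC scalar_ofE idm_one_neq0)
  (hopf_one scalar_ofE idm_one_neq0).
exact/divff/qdim_rep_neq0.
Qed.

Lemma fusion_char_tens_seq j (r : seq C) :
  fusion_char j (tens_seq r) = \prod_(x <- r) fusion_char j x.
Proof.
elim: r => [|x r IHr]; first by rewrite big_nil fusion_char_one.
(* A singleton is its own [tens_seq], with no trailing unit, hence the separate case. *)
rewrite big_cons -IHr; case: r {IHr} => [|y r]; last exact: fusion_char_tens.
by rewrite /= fusion_char_one mulr1.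
Qed.

Lemma fusion_charE i j :
  fusion_char j (rep i) = Smatrix i j / Smatrix (irr0 C) j.
Proof.
rewrite /Smatrix invf_div mulrA divfK ?sqrtC_eq0 ?globaldim_neq0 //.
by rewrite -/(s (irr0 C) j) hopf_irr0.
Qed.

(* The columns of the Hopf matrix diagonalize the fusion matrix of x, the
   eigenvalues being the values of the characters. *)
Lemma fusion_trace x :
  \sum_i (dim (mor (rep i ⊗ x) (rep i)))%:R = \sum_j fusion_char j x.
Proof.
pose N : 'M[K]_#|irr C| := \matrix_(a, b)
  (dim (mor (rep (enum_val a) ⊗ x) (rep (enum_val b))))%:R.
pose D := diag_mx (\row_(b < #|irr C|) fusion_char (enum_val b) x).
have NH : N *m H = H *m D.
  apply/matrixP => a b; rewrite mul_mx_diag !mxE.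
  under eq_bigr do rewrite !mxE.
  (* The left side expands this Hopf invariant over the simple summands, the right side factors it
     by multiplicativity. *)
  transitivity (hopf (rep (enum_val a) ⊗ x) (rep (enum_val b))).
    by rewrite hopf_suml sum_irr.
  by rewrite /fusion_char mulrA -hopf_tens_rep mulfK ?qdim_rep_neq0.
have trN : \tr N = \tr D.
  have Hu : H \in unitmx by exact: hopf_nondegenerate.
  by rewrite -(mulmxK Hu N) NH mxtrace_mulC mulmxA mulVmx // mul1mx.
rewrite !sum_irr; move: trN; rewrite mxtrace_diag /mxtrace.
under eq_bigr do rewrite mxE; move->.
by apply: eq_bigr => b _; rewrite mxE.
Qed.

End Modular.

Theorem proposition6p1 (K : numClosedFieldType) (C : modularCategory K)
    (n : nat) (p : 'I_n -> irr C) :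
  (\dim {: Bl p})%:R =
    \sum_(j : irr C)
      (\prod_(a < n) Smatrix (p a) j) / Smatrix (irr0 C) j ^+ n :> K.
Proof.
set P := tens_seq [seq rep (p a) | a <- enum 'I_n].
have -> : \dim {: Bl p} = \sum_(i : irr C) dim (mor (rep i ⊗ P) (rep i)).
  (* Duality turns Hom(i ⊗ P, i) into Hom(P, dual i ⊗ i), and the braiding swaps the two factors of
     the target. *)
  rewrite dimvf dim_dsum; apply: eq_bigr => i _; rewrite dim_mor_dual.
  by apply: dim_mor_isor; split; exact: braid.
rewrite natr_sum fusion_trace; apply: eq_bigr => j _.
rewrite fusion_char_tens_seq big_map big_enum /=.
under eq_bigr do rewrite fusion_charE.
by rewrite prodf_div prodr_const card_ord.
Qed.
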